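(* Let $f:\mathcal{G}\to\mathbb{R}$ be an edge reflection positive and multiplicative graph parameter. Then there exist an integer $d\ge 0$ and a real valued edge coloring model $t:\mathbb{N}^d\to\mathbb{R}$ with $d$ colors such that $t(G)=f(G)$ for every $G\in\mathcal{G}$.
   Context: A graph is a finite multigraph in which loops and multiple edges are allowed and which may additionally contain circles, i.e. edges having no endpoints; $\mathcal{G}$ denotes the set of isomorphism classes of such graphs (including the empty graph $\emptyset$). $G_1\cup G_2$ denotes disjoint union (of vertex sets and of edge sets). A graph parameter $f:\mathcal{G}\to\mathbb{R}$ is multiplicative if $f(G_1\cup G_2)=f(G_1)f(G_2)$ for all $G_1,G_2$ and $f(\emptyset)=1$. $\mathcal{Q}$ denotes the real vector space of finite formal linear combinations of elements of $\mathcal{G}$ (quantum graphs); graph parameters are extended linearly to $\mathcal{Q}$. For $k\ge 0$, $\mathcal{G}_k$ is the set of (isomorphism classes of) graphs with $k$ open ends labelled $1,\dots,k$: a graph together with $k$ additional labelled points (open ends, which are not vertices), each open end incident with exactly one edge (an edge may join a vertex to an open end, or two open ends). $\mathcal{Q}_k$ is the real span of $\mathcal{G}_k$. The gluing $g(G_1,G_2)\in\mathcal{G}$ of $G_1,G_2\in\mathcal{G}_k$ is obtained by taking the disjoint union, identifying open ends with the same label, and then removing each of these $k$ identified points (which have degree $2$), replacing its two incident edges by a single edge joining their other ends (so closed chains become circles). For $k=0$ gluing is disjoint union. Gluing extends bilinearly to $g:\mathcal{Q}_k\times\mathcal{Q}_k\to\mathcal{Q}$. A graph parameter $f$ is edge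 reflection positive if $f(g(H,H))\ge 0$ for all $k\ge 0$ and all $H\in\mathcal{Q}_k$. Let $\mathbb{N}=\{0,1,2,\dots\}$. A real valued edge coloring model with $d$ colors $c_1,\dots,c_d$ is a map $t:\mathbb{N}^d\to\mathbb{R}$. For $G\in\mathcal{G}$, a coloring $\psi:E(G)\to\{c_1,\dots,c_d\}$ (circles are edges and also get colors) and a vertex $v$, let $v_\psi\in\mathbb{N}^d$ have $i$-th coordinate equal to the number of edges of color $c_i$ incident with $v$, loops counted twice. The partition function is $t(G)=\sum_{\psi:E(G)\to\{c_1,\dots,c_d\}}\prod_{v\in V(G)}t(v_\psi)$ (empty product $=1$). *)

(* Defs.v *)
From HB Require Import structures.
From mathcomp Require Import all_boot all_order all_algebra.
From mathcomp Require Import reals.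
Set Implicit Arguments.
Unset Strict Implicit.
Unset Printing Implicit Defensive.
Import Order.TTheory GRing.Theory Num.Theory.

Local Open Scope ring_scope.

(* Finite multigraphs with loops, multiple edges, circles and k open ends.
   The two extremities of an edge are either half-edges, attached to vertices,
   or open ends. Every open end is an extremity of exactly one edge, so it is
   given directly by that edge. A circle is an edge without extremities; a loop
   is an edge having two half-edges attached to the same vertex. *)
Record fragment (k : nat) := Fragment {
  vertex : finType;
  edge : finType;
  halfedge : finType;
  vertex_of : halfedge -> vertex;
  edge_of : halfedge -> edge;
  open_edge : 'I_k -> edge;
  edge_extremities : forall e : edge,
    (#|[set h | edge_of h == e]| + #|[set i | open_edge i == e]|)%N
      \in [:: 0%N; 2%N]
}.

Definition graph := fragment 0.

Definition isomorphic (k : nat) (G H : fragment k) : Prop :=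
  exists (fV : vertex G -> vertex H) (fE : edge G -> edge H)
         (fH : halfedge G -> halfedge H),
    [/\ bijective fV, bijective fE, bijective fH,
        forall h, vertex_of (fH h) = fV (vertex_of h) &
        (forall h, edge_of (fH h) = fE (edge_of h)) /\
        (forall i, open_edge H i = fE (open_edge G i))].

Definition sum_map (A B C D : Type) (f : A -> C) (g : B -> D) (x : A + B) :
    C + D :=
  match x with inl a => inl (f a) | inr b => inr (g b) end.

Definition ord0_elim (T : Type) (i : 'I_0) : T :=
  match i with Ordinal m lt_m0 => False_rect T (notF lt_m0) end.

Lemma card_ord0_set (P : pred 'I_0) : #|[set i | P i]| = 0%N.
Proof. by apply: eq_card0 => -[]. Qed.

Lemma card_sum_set (A B : finType) (P : pred (A + B)) :
  #|[set x | P x]| = (#|[set a | P (inl a)]| + #|[set b | P (inr b)]|)%N.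
Proof.
rewrite -!sum1dep_card big_sumType /=.
by congr addn.
Qed.

Definition empty_graph : graph.
Proof.
by apply: (@Fragment 0 void void void (fun x => x) (fun x => x) (@ord0_elim _)).
Defined.

Section DisjointUnion.
Variables G1 G2 : graph.

Lemma disjoint_union_extremities (e : edge G1 + edge G2) :
  (#|[set h | sum_map (@edge_of 0 G1) (@edge_of 0 G2) h == e]|
   + #|[set i : 'I_0 | ord0_elim (edge G1 + edge G2) i == e]|)%N
      \in [:: 0%N; 2%N].
Proof.
rewrite card_ord0_set addn0 card_sum_set; case: e => e /=.
  have := edge_extremities e; rewrite card_ord0_set addn0.
  by rewrite [X in (_ + X)%N]eq_card0 ?addn0 // => h; rewrite inE.
have := edge_extremities e; rewrite card_ord0_set addn0.
by rewrite [X in (X + _)%N]eq_card0 // => h; rewrite inE.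
Qed.

Definition disjoint_union : graph :=
  @Fragment 0 (vertex G1 + vertex G2)%type (edge G1 + edge G2)%type
    (halfedge G1 + halfedge G2)%type
    (sum_map (@vertex_of 0 G1) (@vertex_of 0 G2))
    (sum_map (@edge_of 0 G1) (@edge_of 0 G2))
    (@ord0_elim _) disjoint_union_extremities.

End DisjointUnion.

Lemma connected_card (T I : finType) (a b : I -> T) (r : rel T) (x : T) :
  (forall y z, r y z ->
     exists i, y = a i /\ z = b i \/ y = b i /\ z = a i) ->
  (#|[set y | connect r x y]|
     <= #|[set i | connect r x (a i) && connect r x (b i)]|.+1)%N.
Proof.
move=> rP; set C := [set y | _].
pose inner (A : {set T}) := [set i | (a i \in A) && (b i \in A)].
pose good (A : {set T}) :=
  [&& x \in A, A \subset C & (#|A| <= #|inner A|.+1)%N].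
have g0 : good [set x].
  by rewrite /good set11 cards1 sub1set inE connect0.
have [A /maxsetP[/and3P[xA AC cA] maxA] _] := maxset_exists g0.
have -> : [set i | connect r x (a i) && connect r x (b i)] = inner C.
  by apply/setP=> i; rewrite !inE.
suff <- : A = C by [].
apply/eqP; rewrite eqEsubset AC; apply/subsetP=> y; rewrite inE.
case/connectP=> p pth ->.
suff : forall u, u \in A -> path r u p -> last u p \in A by apply.
elim: p {pth} => [|z p IHp] u uA //= /andP[ruz pth].
apply: IHp pth; apply/negPn/negP=> zA.
have [i iP] := rP _ _ ruz.
have zC : z \in C.
  have := subsetP AC _ uA; rewrite !inE => /connect_trans; apply.
  exact: connect1.
have iA : i \notin inner A.
  rewrite inE; apply/negP=> /andP[aA bA].
  by case: iP => -[_ ez]; move: zA; rewrite ez ?aA ?bA.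
have : z |: A = A; last by move=> zAA; rewrite -zAA setU11 in zA.
apply: maxA; last exact: subsetUr.
rewrite /good in_setU xA orbT subUset sub1set zC AC /= cardsU1 zA add1n ltnS.
apply: leq_trans cA _.
have <- : #|i |: inner A| = #|inner A|.+1 by rewrite cardsU1 iA.
apply: subset_leq_card; apply/subsetP=> j; rewrite in_setU1 => /predU1P[->|].
  by rewrite inE !in_setU1; case: iP => -[<- <-]; rewrite uA eqxx ?orbT.
by rewrite !inE => /andP[-> ->]; rewrite !orbT.
Qed.

Section Gluing.
Variables (k : nat) (G1 G2 : fragment k).

Definition glue_rel : rel (edge G1 + edge G2) := fun x y =>
  [exists i : 'I_k,
     (x == inl (open_edge G1 i)) && (y == inr (open_edge G2 i))
  || (x == inr (open_edge G2 i)) && (y == inl (open_edge G1 i))].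

Lemma glue_rel_sym : symmetric glue_rel.
Proof.
by move=> x y; apply/eq_existsb => i; rewrite orbC andbC [X in _ || X]andbC.
Qed.

Lemma glue_connect_sym : connect_sym glue_rel.
Proof. exact/sym_connect_sym/glue_rel_sym. Qed.

(* An edge of the glued graph is a maximal chain of edges of G1 and G2, two
   consecutive ones sharing an identified open end; it is represented by the
   canonical root of the corresponding connected component. *)
Definition glue_edge : finType := {x : edge G1 + edge G2 | roots glue_rel x}.

Definition glue_class (x : edge G1 + edge G2) : glue_edge :=
  exist _ (fingraph.root glue_rel x) (roots_root glue_connect_sym x).

Definition glue_edge_of (h : halfedge G1 + halfedge G2) : glue_edge :=
  glue_class (sum_map (@edge_of k G1) (@edge_of k G2) h).

Lemma glue_extremities (e : glue_edge) :
  (#|[set h | glue_edge_of h == e]|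
   + #|[set i : 'I_0 | ord0_elim glue_edge i == e]|)%N \in [:: 0%N; 2%N].
Proof.
rewrite card_ord0_set addn0.
have classE x : (glue_class x == e) = connect glue_rel (val e) x.
  rewrite -val_eqE /= -(root_connect glue_connect_sym) eq_sym.
  by rewrite (eqP (valP e)).
set n := #|_|.
pose C := [set x | connect glue_rel (val e) x].
pose L := [set i | inl (open_edge G1 i) \in C].
pose deg (x : edge G1 + edge G2) :=
  (#|[set h | sum_map (@edge_of k G1) (@edge_of k G2) h == x]|
   + #|[set i | inl (open_edge G1 i) == x]|
   + #|[set i | inr (open_edge G2 i) == x]|)%N.
have degP x : deg x \in [:: 0%N; 2%N].
  have c0 (I : finType) (P : pred I) : P =1 pred0 -> #|[set i | P i]| = 0%N.
    by move=> P0; apply: eq_card0 => i; rewrite inE P0.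
  rewrite /deg card_sum_set; case: x => x; have := edge_extremities x.
    by rewrite [X in (_ + X + _ + _)%N]c0 // [X in (_ + _ + X)%N]c0 // !addn0.
  by rewrite [X in (X + _ + _ + _)%N]c0 // [X in (_ + X + _)%N]c0 // addn0.
have fib (I : finType) (g : I -> edge G1 + edge G2) :
    (\sum_(x in C) #|[set i | g i == x]| = #|[set i | g i \in C]|)%N.
  rewrite -sum1dep_card (partition_big g [in C]) //=.
  apply: eq_bigr => x xC; rewrite -sum1dep_card; apply: eq_bigl => i.
  by case: eqP => [->|]; rewrite ?xC ?andbF.
have LR : #|[set i | inr (open_edge G2 i) \in C]| = #|L|.
  apply: eq_card => i; rewrite !inE.
  rewrite glue_connect_sym [RHS]glue_connect_sym.
  apply: same_connect; first exact: glue_connect_sym.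
  by apply: connect1; apply/existsP; exists i; rewrite !eqxx orbT.
have nE : n = #|[set h | sum_map (@edge_of k G1) (@edge_of k G2) h \in C]|.
  by apply: eq_card => h; rewrite !inE classE.
have sumdeg : (\sum_(x in C) deg x = n + #|L| + #|L|)%N.
  by rewrite !big_split /= !fib LR -nE.
have le2 : (\sum_(x in C) deg x <= #|C| * 2)%N.
  rewrite -sum_nat_const; apply: leq_sum => x _.
  by have := degP x; rewrite !inE => /orP[] /eqP->.
have evn : ~~ odd (\sum_(x in C) deg x)%N.
  apply: (big_ind (fun m => ~~ odd m)) => //.
    by move=> p q op oq; rewrite oddD (negbTE op) (negbTE oq).
  by move=> x _; have := degP x; rewrite !inE => /orP[] /eqP->.
have leC : (#|C| <= #|L|.+1)%N.
  have := @connected_card _ _ (fun i => inl (open_edge G1 i))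
    (fun i => inr (open_edge G2 i)) glue_rel (val e).
  move=> /(_ _)/leq_trans; apply.
    move=> y z /existsP[i /orP[] /andP[/eqP-> /eqP->]]; exists i;
      by [left | right].
  rewrite ltnS; apply: subset_leq_card; apply/subsetP=> i.
  by rewrite !inE => /andP[].
move: evn le2; rewrite sumdeg -addnA addnn oddD odd_double addbF => evn le2.
have : (n <= 2)%N.
  rewrite -(leq_add2r #|L|.*2); apply: leq_trans le2 _.
  by rewrite muln2 -[(2 + _)%N]/((#|L|.+1).*2) leq_double.
by move: evn; case: n {nE sumdeg le2} => [|[|[|]]].
Qed.

Definition glue : graph :=
  @Fragment 0 (vertex G1 + vertex G2)%type glue_edge
    (halfedge G1 + halfedge G2)%type
    (sum_map (@vertex_of k G1) (@vertex_of k G2))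
    glue_edge_of (@ord0_elim _) glue_extremities.

End Gluing.

Definition graph_parameter (R : realType) (f : graph -> R) : Prop :=
  forall G H : graph, isomorphic G H -> f G = f H.

Definition multiplicative (R : realType) (f : graph -> R) : Prop :=
  (forall G1 G2 : graph, f (disjoint_union G1 G2) = f G1 * f G2)
  /\ f empty_graph = 1.

(* The formal linear combination \sum_j c_j G_j, as the list of its terms
   (c_j, G_j). Repeated or isomorphic G_j are allowed; this is harmless since
   quantum graphs are only used through the evaluation below. *)
Definition quantum (R : realType) (k : nat) := seq (R * fragment k).

Definition quantum_eval (R : realType) (f : graph -> R) (Q : quantum R 0) : R :=
  \sum_(p <- Q) p.1 * f p.2.

Definition quantum_glue (R : realType) (k : nat) (Q1 Q2 : quantum R k) :
    quantum R 0 :=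
  [seq (p.1 * q.1, glue p.2 q.2) | p <- Q1, q <- Q2].

Definition edge_reflection_positive (R : realType) (f : graph -> R) : Prop :=
  forall (k : nat) (H : quantum R k), 0 <= quantum_eval f (quantum_glue H H).

Definition edge_coloring_model (R : realType) (d : nat) :=
  {ffun 'I_d -> nat} -> R.

(* Counting half-edges makes loops count twice. *)
Definition color_degrees (d : nat) (G : graph) (psi : {ffun edge G -> 'I_d})
    (v : vertex G) : {ffun 'I_d -> nat} :=
  [ffun c => #|[set h : halfedge G | (vertex_of h == v)
                                 && (psi (edge_of h) == c)]|].

Definition partition_function (R : realType) (d : nat)
    (t : edge_coloring_model R d) (G : graph) : R :=
  \sum_(psi : {ffun edge G -> 'I_d}) \prod_(v : vertex G) t (color_degrees psi v).

(* Main.v *)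
From Pilot Require Import Defs.
From HB Require Import structures.
From mathcomp Require Import all_boot all_order all_fingroup all_algebra.
From mathcomp Require Import boolp reals ring lra.
From mathcomp Require classical_sets sesquilinear spectral complex finmap.
From mathcomp.multinomials Require monalg.
Set Implicit Arguments.
Unset Strict Implicit.
Unset Printing Implicit Defensive.
Import Order.TTheory GRing.Theory Num.Theory.
Local Open Scope ring_scope.

(* The circle has a value d in N, because antisymmetrizing the k! ways of
   joining k open ends to k open ends makes d (d - 1) ... (d - k + 1)
   nonnegative for every k. For a fixed set of half-edges, a way P of pairing
   them into edges gives a tensor T_P in (R^d)^(tensor n), counting the
   compatible edge colorings, and by Cauchy-Schwarz f factors through these
   tensors. Let K be the tensor in the span of all T_P such that <K, T_P> is
   the value of f, for a given attachment of the half-edges to vertices. The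
   entries of K define a linear functional L on the polynomial ring in the
   variables y_a, a in N^d; it plays the role of f composed with averaging over
   the orthogonal group, but no invariant theory is needed:
   - L (q_G b) = f(G) L(b), where q_G is the partition function of G as a
     polynomial in the y_a, by uniqueness of K;
   - L (b^2) >= 0, because the entries of K form a symmetric matrix M lying in
     a matrix algebra on which reflection positivity says tr (M B^2) >= 0, and
     testing B = p(M) excludes negative eigenvalues.
   The quadratic module { a | L (a b^2) >= 0 for all b } is archimedean, since
   the graph with two vertices joined by |a| edges bounds y_a^2. A maximal
   proper quadratic module containing it yields a ring morphism chi to R with
   chi (q_G) = f(G), and t(a) = chi (y_a) is the required model. *)

(** * Archimedean quadratic modules *)

Section QuadraticModule.
Import classical_sets.
Variables (R : realType) (A : comAlgType R).
Implicit Types (S : set A) (a b : A) (c r : R).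

Definition quadratic_module S :=
  [/\ S 1, forall a b, S a -> S b -> S (a + b)
    & forall a b, S a -> S (a * b ^+ 2)].

(** A nonnegative constant is the square of the constant [Num.sqrt c]. *)
Lemma qm_scale S a c : quadratic_module S -> 0 <= c -> S a -> S (c *: a).
Proof.
case=> _ _ Sm c0 Sa; have := Sm a (Num.sqrt c)%:A Sa.
by rewrite exprZn expr1n sqr_sqrtr // mulr_algr.
Qed.

Lemma qm_sqr S b : quadratic_module S -> S (b ^+ 2).
Proof. by case=> S1 _ Sm; rewrite -[b ^+ 2]mul1r; apply: Sm. Qed.

Lemma qm_const S c : quadratic_module S -> 0 <= c -> S c%:A.
Proof. by move=> qS c0; apply: qm_scale => //; case: qS. Qed.

Lemma qm_sum_sqr S (J : Type) (r : seq J) (P : pred J) (F : J -> A) :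
  quadratic_module S -> S (\sum_(j <- r | P j) F j ^+ 2).
Proof.
move=> qS; have [_ SD _] := qS; apply: (big_ind S) => [||j _].
- by rewrite -(scale0r (1 : A)); apply: qm_const.
- exact: SD.
- exact: qm_sqr.
Qed.

(* Polarization: [a * b] is a difference of elements [a * u ^+ 2]. *)
Lemma qm_support_ideal S a b :
  quadratic_module S -> S a -> S (- a) -> S (a * b).
Proof.
move=> [_ Sa Sm] pa na.
have -> : a * b = a * (2^-1 *: (b + 1)) ^+ 2 + (- a) * (2^-1 *: (b - 1)) ^+ 2.
  rewrite !exprZn -!scalerAr mulNr scalerN -scalerBr -mulrBr.
  have -> : (b + 1) ^+ 2 - (b - 1) ^+ 2 = 4 *: b.
    by rewrite scaler_nat; ring.
  by rewrite -scalerAr scalerA (_ : 2^-1 ^+ 2 * 4 = 1) ?scale1r //; field.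
by apply: Sa; apply: Sm.
Qed.

Lemma maximal_quadratic_module S0 :
  quadratic_module S0 -> ~ S0 (- 1) ->
  exists S, [/\ (S0 `<=` S)%classic, quadratic_module S, ~ S (- 1)
    & forall S', (S `<=` S')%classic -> quadratic_module S' ->
        ~ S' (- 1) -> (S' `<=` S)%classic].
Proof.
move=> q0 n0.
pose P (S : set A) := S = set0 \/ [/\ (S0 `<=` S)%classic, quadratic_module S & ~ S (- 1)].
have [F FP totF | M [PM maxM]] := @Zorn_bigcup A P.
  have [[X FX X0] | noX] := pselect (exists2 X, F X & X <> set0); last first.
    left; apply/seteqP; split => // x [X FX Xx].
    by case: noX; exists X => // X0; rewrite X0 in Xx.
  right; have good Y : F Y -> Y <> set0 -> [/\ (S0 `<=` Y)%classic, quadratic_module Y & ~ Y (- 1)].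
    by move=> FY Y0; case: (FP _ FY).
  have [sX [X1 XD XM] nX] := good _ FX X0.
  have inF Y y : F Y -> Y y -> Y <> set0 by move=> _ Yy Y0; rewrite Y0 in Yy.
  split.
  - by move=> x /sX Xx; exists X.
  - split; first by exists X.
    + move=> a b [Y FY Ya] [Z FZ Zb].
      have [_ [_ YD _] _] := good _ FY (inF _ _ FY Ya).
      have [_ [_ ZD _] _] := good _ FZ (inF _ _ FZ Zb).
      have [YZ|ZY] := totF _ _ FY FZ.
        by exists Z => //; apply: ZD => //; apply: YZ.
      by exists Y => //; apply: YD => //; apply: ZY.
    + move=> a b [Y FY Ya]; exists Y => //.
      by have [_ [_ _ YM] _] := good _ FY (inF _ _ FY Ya); apply: YM.
  - move=> [Y FY Ya].
    by have [_ _] := good _ FY (inF _ _ FY Ya).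
have M0 : M <> set0.
  move=> M0; have : ~ (M `<` S0)%classic by move/maxM => nP; apply: nP; right; split.
  apply; split; first by rewrite M0.
  by move=> /(_ 1); rewrite M0; apply; case: q0.
case: PM => // -[sM qM nM]; exists M; split => // S' sS' qS' nS'.
apply/asboolP/negPn/negP => /asboolPn ns.
have : ~ P S' by apply: maxM; split.
by apply; right; split=> // x /sM /sS'.
Qed.

(* Archimedean representation: on a maximal proper quadratic module every
   element is congruent to a real constant modulo the support ideal. *)
Lemma archimedean_character S0 :
  quadratic_module S0 -> ~ S0 (- 1) ->
  (forall a, exists c, S0 (c%:A - a)) ->
  exists chi : {lrmorphism A -> R^o},
    forall a c, S0 (a - c%:A) -> S0 (c%:A - a) -> chi a = c.
Proof.
move=> q0 n0 arch.
have [S [sS qS nS maxS]] := maximal_quadratic_module q0 n0.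
have [S1 SD SM] := qS.
have nneg c : c < 0 -> ~ S c%:A.
  move=> c0 /(qm_scale (c := - c^-1) qS).
  rewrite oppr_ge0 invr_le0 => /(_ (ltW c0)).
  by rewrite scalerA mulNr mulVf ?lt_eqF // scaleN1r.
(* If neither lies in [S], maximality puts [- 1] in both [S] plus [a] times sums of squares and [S]
   minus [a] times sums of squares. *)
have total a : S a \/ S (- a).
  apply: contrapT => /not_orP[na nna].
  pose ext a (x : A) := exists2 s, S s & exists2 t, 
    (exists u : seq A, t = \sum_(b <- u) b ^+ 2) & x = s + a * t.
  have qext b : quadratic_module (ext b).
    split.
    - by exists 1 => //; exists 0; [exists [::]; rewrite big_nil|rewrite mulr0 addr0].
    - move=> x y [s Ss [t [u ->] ->]] [s' Ss' [t' [u' ->] ->]].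
      exists (s + s'); first exact: SD.
      exists (\sum_(b <- u ++ u') b ^+ 2); first by exists (u ++ u').
      by rewrite big_cat /=; ring.
    - move=> x y [s Ss [t [u ->] ->]]; exists (s * y ^+ 2); first exact: SM.
      exists (\sum_(b <- [seq b * y | b <- u]) b ^+ 2); first by exists [seq b * y | b <- u].
      rewrite big_map; under eq_bigr do rewrite exprMn.
      by rewrite -big_distrl /=; ring.
  have ext_sub b : (S `<=` ext b)%classic.
    by move=> s Ss; exists s => //; exists 0; [exists [::]; rewrite big_nil|rewrite mulr0 addr0].
  have ext_in b : ext b b.
    exists 0; first by rewrite -(scale0r (1 : A)); apply: qm_const.
    by exists 1; [exists [:: 1]; rewrite big_seq1 expr1n|rewrite mulr1 add0r].
  have ext_neg b : ~ S b -> ext b (- 1).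
    move=> nb; apply: contrapT => ne; apply: nb.
    by apply: (maxS _ (ext_sub b) (qext b) ne).
  have [s1 Ss1 [t1 [u1 t1E] E1]] := ext_neg _ na.
  have [s2 Ss2 [t2 [u2 t2E] E2]] := ext_neg _ nna.
  have SMs s u : S s -> S (s * \sum_(b <- u) b ^+ 2).
    move=> Ss; rewrite big_distrr /=; elim: u => [|b u IHu].
      by rewrite big_nil -(scale0r (1 : A)); apply: qm_const.
    by rewrite big_cons; apply: SD => //; apply: SM.
  have St1 : S t1 by rewrite t1E -[X in S X]mul1r; apply: SMs.
  (* Eliminating [a] between the two expressions of [- 1] gives this identity. Then [t1] and [- t1]
     both lie in [S], hence so does [a * t1], and [- 1 = s1 + a * t1] follows. *)
  have Snt1 : S (- t1).
    have -> : - t1 = t2 + s1 * t2 + s2 * t1.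
      have e1 : s1 = - 1 - a * t1 by rewrite E1 addrK.
      have e2 : s2 = - 1 + a * t2 by rewrite E2; ring.
      by rewrite e1 e2; ring.
    apply: (SD); last by rewrite t1E; apply: SMs.
    apply: (SD); last by rewrite t2E; apply: SMs.
    by rewrite t2E -[X in S X]mul1r; apply: SMs.
  apply: nS; rewrite E1; apply: SD => //.
  by rewrite mulrC; apply: qm_support_ideal.
(* The closure [S'] is again a proper quadratic module, so maximality puts it inside [S]. Stability
   under multiplication by [y ^+ 2] rests on the archimedean bound of [y ^+ 2]. *)
have closed a : (forall e, 0 < e -> S (a + e%:A)) -> S a.
  pose S' : set A := fun a => forall e : R, 0 < e -> S (a + e%:A).
  apply: (maxS S').
  - by move=> s Ss e e0; apply: SD => //; apply: qm_const => //; apply: ltW.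
  - split.
    + by move=> e e0; apply: SD => //; apply: qm_const => //; apply: ltW.
    + move=> x y Sx Sy e e0; have e20 : 0 < e / 2 by rewrite divr_gt0.
      have -> : x + y + e%:A = (x + (e / 2)%:A) + (y + (e / 2)%:A).
        rewrite addrACA -scalerDl; congr (_ + _ *: _); lra.
      by apply: SD; [apply: Sx | apply: Sy].
    + move=> x y Sx e e0; have [c Sc] := arch (y ^+ 2).
      pose c' := Num.max c 1.
      have c'0 : 0 < c' by rewrite lt_max ltr01 orbT.
      have Sc' : S (c'%:A - y ^+ 2).
        have -> : c'%:A - y ^+ 2 = (c' - c)%:A + (c%:A - y ^+ 2).
          by rewrite scalerBl; ring.
        apply: SD; last exact: sS.
        by apply: qm_const => //; rewrite subr_ge0 le_max lexx.
      have ec : 0 < e / c' by rewrite divr_gt0.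
      have -> : x * y ^+ 2 + e%:A =
         (x + (e / c')%:A) * y ^+ 2 + (e / c') *: (c'%:A - y ^+ 2).
        rewrite mulrDl mulr_algl scalerBr scalerA divfK ?gt_eqF //.
        by rewrite addrA addrAC addrK //; ring.
      apply: SD; first by apply: SM; apply: Sx.
      by apply: qm_scale => //; apply: ltW.
  - move=> /(_ 2^-1) /(_ _); rewrite invr_gt0 ltr0n => /(_ isT).
    rewrite -scaleN1r -scalerDl => /(nneg _); apply; lra.
(* The support of [S]: an ideal containing no nonzero constant, so each class modulo it holds at
   most one constant. *)
pose p a := S a /\ S (- a).
have pD a b : p a -> p b -> p (a + b).
  by move=> [? ?] [? ?]; split; rewrite ?opprD; apply: SD.
have pN a : p a -> p (- a) by move=> [? ?]; split; rewrite ?opprK.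
have pM a b : p a -> p (a * b).
  move=> [? ?]; split; first exact: qm_support_ideal.
  by rewrite -mulNr; apply: qm_support_ideal; rewrite ?opprK.
have p_inj c c' a : p (a - c%:A) -> p (a - c'%:A) -> c = c'.
  move=> h h'; have [h1 h2] : p (c - c')%:A.
    have -> : (c - c')%:A = (a - c'%:A) - (a - c%:A) by rewrite scalerBl; ring.
    by apply: pD => //; apply: pN.
  have [lt|gt|//] := ltgtP c c'.
    by case: (nneg _ _ h1); rewrite subr_lt0.
  by case: (nneg (- (c - c'))); rewrite ?scaleNr // oppr_lt0 subr_gt0.
(* The constant is the supremum of the lower bounds of [a]. Approximation from below gives one sign;
   just above the supremum, [total] leaves only the other sign. *)
have ex a : exists c, p (a - c%:A).
  pose E := [set r : R | S (a - r%:A)]%classic.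
  have E0 : (E !=set0)%classic.
    have [c Sc] := arch (- a); exists (- c).
    by rewrite /E /= scaleNr opprK addrC -[a]opprK; apply: sS.
  have ubE : has_ubound E.
    have [c Sc] := arch a; exists c => r Sr; rewrite leNgt; apply/negP => lt.
    apply: (nneg (c - r)); first by rewrite subr_lt0.
    have -> : (c - r)%:A = (c%:A - a) + (a - r%:A) :> A by rewrite scalerBl; ring.
    by apply: SD => //; apply: sS.
  exists (sup E); split; apply: closed => e e0.
    have [r Er lr] := sup_adherent e0 (conj E0 ubE).
    have -> : a - (sup E)%:A + e%:A = (a - r%:A) + (r - (sup E - e))%:A.
      by rewrite !scalerBl; ring.
    by apply: SD => //; apply: qm_const => //; rewrite subr_ge0 ltW.
  have [|] := total (a - (sup E + e)%:A); last by rewrite scalerDl !opprD !opprK addrA.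
  move=> Sa; have := ub_le_sup ubE Sa; rewrite gerDl leNgt.
  by move=> /negP[].
have [chi chiP] := choice ex.
have chi_eq a c : p (a - c%:A) -> chi a = c by move=> h; apply: p_inj (chiP a) h.
have chi_lin : linear_for *%R chi.
  move=> c a b; apply: chi_eq.
  have -> : c *: a + b - (c * chi a + chi b)%:A =
      (a - (chi a)%:A) * c%:A + (b - (chi b)%:A).
    by rewrite mulr_algr scalerBr scalerA scalerDl; ring.
  by apply: pD; [apply: pM|].
have chi_mul : monoid_morphism chi.
  split; first by apply: chi_eq; rewrite scale1r subrr; split;
    rewrite ?oppr0 -(scale0r (1 : A)); apply: qm_const.
  move=> a b; apply: chi_eq.
  have -> : a * b - (chi a * chi b)%:A =
      (a - (chi a)%:A) * b + (b - (chi b)%:A) * (chi a)%:A.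
    by rewrite -scalerA -mulr_algl; ring.
  by apply: pD; apply: pM.
pose chiL := GRing.isLinear.Build R A R^o *%R chi chi_lin.
pose chiM := GRing.isMonoidMorphism.Build A R^o chi chi_mul.
pose chi' : {lrmorphism A -> R^o} := HB.pack (chi : A -> R^o) chiL chiM.
exists chi' => a c h1 h2; apply: chi_eq; split; first exact: sS.
by rewrite opprB; apply: sS.
Qed.

(** Bounding the square controls [a] from both sides, which makes the bounded elements a subalgebra;
    it is then enough to bound generators. *)
Definition qm_bounded S a := exists2 c, 0 <= c & S (c%:A - a ^+ 2).

(** Parallelogram identity: twice the two squares minus [(a + b) ^+ 2] is [(a - b) ^+ 2]. *)
Lemma qm_boundedD S a b : quadratic_module S ->
  qm_bounded S a -> qm_bounded S b -> qm_bounded S (a + b).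
Proof.
move=> qS [c c0 Sa] [e e0 Sb]; have [_ SD _] := qS.
exists (2 * c + 2 * e); first by rewrite addr_ge0 // mulr_ge0.
have -> : (2 * c + 2 * e)%:A - (a + b) ^+ 2
    = (2 *: (c%:A - a ^+ 2) + 2 *: (e%:A - b ^+ 2)) + (a - b) ^+ 2.
  by rewrite scalerDl -!scalerA !scaler_nat; ring.
by apply: (SD); [apply: SD; apply: qm_scale | apply: qm_sqr].
Qed.

Lemma qm_boundedM S a b : quadratic_module S ->
  qm_bounded S a -> qm_bounded S b -> qm_bounded S (a * b).
Proof.
move=> qS [c c0 Sa] [e e0 Sb]; have [_ SD SM] := qS.
exists (c * e); first by rewrite mulr_ge0.
have -> : (c * e)%:A - (a * b) ^+ 2
    = e *: (c%:A - a ^+ 2) + (e%:A - b ^+ 2) * a ^+ 2.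
  by rewrite [c * e]mulrC -scalerA -(mulr_algl e (_ - _)) -(mulr_algl e c%:A); ring.
by apply: SD; [apply: qm_scale | apply: SM].
Qed.

Lemma qm_bounded_const S c : quadratic_module S -> qm_bounded S c%:A.
Proof.
move=> qS; exists (c ^+ 2); first exact: sqr_ge0.
by rewrite exprZn expr1n subrr -(scale0r (1 : A)); apply: qm_const.
Qed.

(** Completing the square; the constant [4^-1] is the square of the shift [2^-1]. *)
Lemma qm_bounded_le S a : quadratic_module S -> qm_bounded S a ->
  exists c, S (c%:A - a).
Proof.
move=> qS [c _ Sa]; have [_ SD _] := qS; exists (c + 4^-1).
have -> : (c + 4^-1)%:A - a = (c%:A - a ^+ 2) + (a - (2^-1)%:A) ^+ 2.
  have h4 : (4^-1)%:A = (2^-1)%:A ^+ 2 :> A.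
    by rewrite exprZn expr1n; congr (_ *: _); field.
  have h2 : a * (2^-1)%:A *+ 2 = a.
    by rewrite mulr_algr -scaler_nat scalerA mulfV ?scale1r ?pnatr_eq0.
  rewrite scalerDl h4 sqrrB h2; ring.
by apply: SD => //; apply: qm_sqr.
Qed.

End QuadraticModule.

(** * A criterion for positive semidefiniteness *)

Section Diagonalized.
Variables (R : realFieldType) (C : numClosedFieldType) (rc : {rmorphism R -> C}).
Hypotheses (rc_ge0 : forall x, (0 <= rc x) = (0 <= x))
  (rc_conj : forall x, (rc x)^* = rc x).
Variables (n : nat) (K : 'M[R]_n) (P : 'M[C]_n) (D : 'rV[R]_n).
Hypotheses (Ksym : K^T = K) (Pu : P \in unitmx)
  (PV : invmx P = (map_mx Num.conj P)^T)
  (KE : map_mx rc K = invmx P *m diag_mx (map_mx rc D) *m P).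

(* A negative eigenvalue [l] of [K] would be detected by [B = p(K)], where the
   polynomial [p] vanishes at [0] and at all eigenvalues other than [l]. *)
Lemma psd_of_trace_diagonalized (S : 'M[R]_n -> Prop) :
  S K ->
  (forall A B, S A -> S B -> S (A + B)) ->
  (forall c A, S A -> S (c *: A)) ->
  (forall A B, S A -> S B -> S (A *m B)) ->
  (forall B, S B -> B^T = B -> 0 <= \tr (K *m (B *m B))) ->
  forall x : 'rV[R]_n, 0 <= (x *m K *m x^T) 0 0.
Proof.
move=> SK SD SZ SM trP x; have rc_inj : injective rc := fmorph_inj rc.
(* The leading factor [K] keeps the polynomial in [K] inside [S], which need not contain the
   identity. *)
pose B s := foldr (fun m B => B *m (K - m%:M)) K s.
have BP s : [/\ S (B s), (B s)^T = B s & B s *m K = K *m B s].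
  elim: s => [//|m s [SB Bsym Bcomm]] /=; split.
  - rewrite mulmxBr mul_mx_scalar -scaleNr.
    by apply: SD; [apply: SM|apply: SZ].
  - by rewrite trmx_mul Bsym linearB /= Ksym tr_scalar_mx mulmxBr mulmxBl
      Bcomm mul_mx_scalar mul_scalar_mx.
  - rewrite -mulmxA mulmxBl mul_scalar_mx -mul_mx_scalar -mulmxBr !mulmxA.
    by rewrite Bcomm.
pose b s (i : 'I_n) := D 0 i * \prod_(m <- s) (D 0 i - m).
have mulPdP (u v : 'rV[C]_n) :
   (invmx P *m diag_mx u *m P) *m (invmx P *m diag_mx v *m P) =
   invmx P *m diag_mx (\row_i (u 0 i * v 0 i)) *m P.
  rewrite !mulmxA mulmxK // -[_ *m diag_mx u *m _]mulmxA mulmx_diag.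
  by [].
have BE s : map_mx rc (B s) = invmx P *m diag_mx (\row_i rc (b s i)) *m P.
  elim: s => [|m s IHs] /=.
    rewrite KE; congr (_ *m diag_mx _ *m _); apply/rowP => i.
    by rewrite !mxE /b big_nil mulr1.
  rewrite map_mxM map_mxB map_scalar_mx /= IHs KE.
  have -> : (rc m)%:M = invmx P *m diag_mx (const_mx (rc m)) *m P.
    by rewrite diag_const_mx mul_mx_scalar -scalemxAl mulVmx // scalemx1.
  rewrite -mulmxBl -mulmxBr -linearB /= mulPdP.
  congr (_ *m diag_mx _ *m _); apply/rowP => i.
  by rewrite !mxE /b big_cons -rmorphB -rmorphM /=; congr (rc _); ring.
have Dge0 i : 0 <= D 0 i.
  rewrite leNgt; apply/negP => Di.
  (* All eigenvalues other than [D 0 i]: in the trace only the copies of [D 0 i] survive, and they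
     all contribute the same negative amount. *)
  pose s := [seq m <- [seq D 0 j | j <- enum 'I_n] | m != D 0 i].
  have [SB Bsym _] := BP s; have := trP _ SB Bsym; apply/negP; rewrite -ltNge.
  suff -> : \tr (K *m (B s *m B s)) = \sum_j D 0 j * b s j ^+ 2.
    have bi : b s i != 0.
      rewrite /b mulf_eq0 lt_eqF //= prodf_seq_neq0; apply/allP => m.
      by rewrite mem_filter => /andP[mi _] /=; rewrite subr_eq0 eq_sym.
    rewrite (bigD1 i) //= ltr_wnDr //; last first.
      by rewrite nmulr_rlt0 // exprn_even_gt0.
    apply: sumr_le0 => j _; have [Dj|Dj] := eqVneq (D 0 j) (D 0 i).
      by rewrite Dj mulr_le0_ge0 ?sqr_ge0 // ltW.
    suff -> : b s j = 0 by rewrite expr0n mulr0.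
    rewrite /b; apply/eqP; rewrite mulf_eq0; apply/orP; right.
    rewrite prodf_seq_eq0; apply/hasP; exists (D 0 j); last by rewrite /= subrr.
    by rewrite mem_filter Dj; apply/mapP; exists j; rewrite ?mem_enum.
  apply: rc_inj; rewrite -trace_map_mx !map_mxM KE BE !mulPdP.
  rewrite mxtrace_mulC mulmxA mulmxV // mul1mx mxtrace_diag rmorph_sum.
  by apply: eq_bigr => j _; rewrite !mxE expr2 !rmorphM.
rewrite -rc_ge0.
(* In the eigenbasis the form is the sum of the eigenvalues weighted by the squared moduli of the
   entries of [y]. *)
pose y := P *m map_mx rc x^T.
have yE : map_mx rc x *m invmx P = (map_mx Num.conj y)^T.
  rewrite /y map_mxM trmx_mul PV; congr (_ *m _).
  by apply/matrixP => i j; rewrite !mxE; apply/esym/rc_conj.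
have -> : rc ((x *m K *m x^T) 0 0) = (map_mx rc (x *m K *m x^T)) 0 0.
  by rewrite [RHS]mxE.
rewrite !map_mxM KE !mulmxA yE -mulmxA -/y mxE; apply: sumr_ge0 => i _.
rewrite mul_mx_diag !mxE mulrAC mulr_ge0 //.
  by rewrite mulrC mul_conjC_ge0.
by rewrite rc_ge0.
Qed.

End Diagonalized.

Section PositiveSemidefinite.
Import sesquilinear spectral complex.
Variables (R : rcfType) (n : nat).
Local Notation rc := (real_complex R).

(** Over [R[i]] the matrix is Hermitian, so the spectral theorem for normal matrices applies and the
    eigenvalues are real. The change of basis may stay complex. *)
Lemma real_symmetric_diagonalization (K : 'M[R]_n) : K^T = K ->
  exists2 P : 'M[R[i]]_n, P \in unitmx & exists D : 'rV[R]_n,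
    map_mx (real_complex R) K
      = invmx P *m diag_mx (map_mx (real_complex R) D) *m P
    /\ invmx P = (map_mx Num.conj P)^T.
Proof.
move=> Ksym; pose Kc := map_mx (real_complex R) K.
have Kreal : Kc \is a mxOver Num.real.
  by apply/mxOverP => i j; rewrite mxE; apply/complex_realP; exists (K i j).
have Kherm : Kc \is hermsymmx.
  apply: realsym_hermsym => //; apply/is_hermitianmxP.
  by rewrite expr0 scale1r map_mx_id // map_trmx Ksym.
have /orthomx_spectralP KcE := hermitian_normalmx Kherm.
have /mxOverP Dr := hermitian_spectral_diag_real Kherm.
exists (spectralmx Kc); first exact: spectral_unit.
exists (map_mx (@complex.Re R) (spectral_diag Kc)); split; last first.
  by rewrite invmx_unitary ?spectral_unitarymx // map_trmx.
have -> : map_mx rc (map_mx (@complex.Re R) (spectral_diag Kc)) = spectral_diag Kc.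
  by apply/matrixP => i j; rewrite !mxE RRe_real.
exact: KcE.
Qed.

Lemma psd_of_trace (K : 'M[R]_n) (S : 'M[R]_n -> Prop) :
  K^T = K -> S K ->
  (forall A B, S A -> S B -> S (A + B)) ->
  (forall c A, S A -> S (c *: A)) ->
  (forall A B, S A -> S B -> S (A *m B)) ->
  (forall B, S B -> B^T = B -> 0 <= \tr (K *m (B *m B))) ->
  forall x : 'rV[R]_n, 0 <= (x *m K *m x^T) 0 0.
Proof.
move=> Ksym SK SD SZ SM trP x.
have [P Pu [D [KE PV]]] := real_symmetric_diagonalization Ksym.
apply: (@psd_of_trace_diagonalized R R[i] (real_complex R) _ _ n K P D _ _ _ _ S) => //.
- by move=> y; apply: ler0c.
- by move=> y; apply: conjc_real.
Qed.

End PositiveSemidefinite.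

(** * Spans and the Riesz representation *)

(* [exchange_big] does not apply to the index types used below, which live in
   a universe as large as that of [finType] itself. *)
Lemma exchange_sum_seq (R : nmodType) (W : finType) (I : Type) (s : seq I)
    (F : W -> I -> R) :
  \sum_w \sum_(p <- s) F w p = \sum_(p <- s) \sum_w F w p.
Proof.
elim: s => [|p s IHs]; first by under eq_bigr do rewrite big_nil; rewrite big1_eq big_nil.
by under eq_bigr do rewrite big_cons; rewrite big_split IHs big_cons.
Qed.

Section Span.
Variables (R : realType) (W : finType) (I : Type) (x : I -> W -> R).
Implicit Types (s : seq (R * I)) (a b : W -> R).

Definition lincomb s (w : W) : R := \sum_(p <- s) p.1 * x p.2 w.

Definition in_span a := exists s, a =1 lincomb s.

Lemma in_span_gen i : in_span (x i).
Proof. by exists [:: (1, i)] => w; rewrite /lincomb big_seq1 mul1r. Qed.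

Lemma in_span_ext a b : a =1 b -> in_span a -> in_span b.
Proof. by move=> ab [s as_]; exists s => w; rewrite -ab. Qed.

Lemma in_spanD a b : in_span a -> in_span b -> in_span (fun w => a w + b w).
Proof.
move=> [s as_] [t bt]; exists (s ++ t) => w.
by rewrite /lincomb big_cat /= as_ bt.
Qed.

Lemma in_spanZ c a : in_span a -> in_span (fun w => c * a w).
Proof.
move=> [s as_]; exists [seq (c * p.1, p.2) | p <- s] => w.
rewrite /lincomb big_map as_ /lincomb big_distrr /=.
by apply: eq_bigr => p _; rewrite mulrA.
Qed.

Lemma in_span0 : in_span (fun=> 0).
Proof. by exists [::] => w; rewrite /lincomb big_nil. Qed.

Lemma in_span_sum (J : Type) (r : seq J) (P : pred J) (F : J -> W -> R) :
  (forall j, P j -> in_span (F j)) ->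
  in_span (fun w => \sum_(j <- r | P j) F j w).
Proof.
move=> FP; elim: r => [|j r IHr].
  by apply: in_span_ext in_span0 => w; rewrite big_nil.
have [Pj|Pj] := boolP (P j).
  apply: in_span_ext (in_spanD (FP j Pj) IHr) => w.
  by rewrite big_cons Pj.
by apply: in_span_ext IHr => w; rewrite big_cons (negbTE Pj).
Qed.

(** An element of the span orthogonal to all generators is orthogonal to itself, and the standard
    form on real vectors is definite. *)
Lemma in_span_eq0 a : in_span a ->
  (forall i, \sum_w a w * x i w = 0) -> forall w, a w = 0.
Proof.
move=> [s as_] a0 w.
have : \sum_w a w * a w = 0.
  under eq_bigr => v _ do rewrite {2}as_ big_distrr /=.
  rewrite exchange_sum_seq big1 // => p _.
  under eq_bigr => v _ do rewrite mulrCA.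
  by rewrite -big_distrr /= a0 mulr0.
move/eqP; rewrite psumr_eq0 => [|v _]; last by rewrite -expr2 sqr_ge0.
move/allP/(_ w (mem_index_enum _)); rewrite /= mulf_eq0 orbb.
by move/eqP.
Qed.

Lemma in_span_inj a b : in_span a -> in_span b ->
  (forall i, \sum_w a w * x i w = \sum_w b w * x i w) -> a =1 b.
Proof.
move=> sa sb ab w; apply/eqP; rewrite -subr_eq0; apply/eqP.
have sab : in_span (fun w => a w + (-1) * b w).
  by apply: in_spanD => //; apply: in_spanZ.
rewrite -[LHS](_ : a w + (-1) * b w = _); last by rewrite mulN1r.
apply: (in_span_eq0 sab) => i.
under eq_bigr => v _ do rewrite mulN1r mulrBl.
by rewrite sumrB ab subrr.
Qed.

(** The family is indexed by an arbitrary type, but its span is finite dimensional: a finite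
    subfamily of maximal rank spans it, and the coefficients of [K] solve the linear system of its
    Gram matrix. *)
Lemma riesz_in_span (phi : I -> R) :
  (forall s, (forall w, lincomb s w = 0) -> \sum_(p <- s) p.1 * phi p.2 = 0) ->
  exists2 K, in_span K & forall i, \sum_w K w * x i w = phi i.
Proof.
move=> phi0.
pose v i : 'rV[R]_#|W| := \row_k x i (enum_val k).
pose mx m (g : 'I_m -> I) := \matrix_(j < m) v (g j).
pose Q r := `[< exists m (g : 'I_m -> I), \rank (mx m g) = r >].
have exQ : exists r, Q r.
  exists (\rank (mx 0 (fun j : 'I_0 => match j with Ordinal _ h => match notF h with end end))).
  by apply/asboolP; do 2 eexists.
have leQ r : Q r -> (r <= #|W|)%N.
  by move/asboolP=> [m [g <-]]; apply: rank_leq_col.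
case: (ex_maxnP exQ leQ) => r /asboolP[m [g rkg]] maxr.
have vs i : (v i <= mx m g)%MS.
  (* Adding the generator [i] to the subfamily cannot increase the maximal rank. *)
  pose g' (j : 'I_m.+1) := if unlift ord0 j is Some j' then g j' else i.
  have le_g : (mx m g <= mx m.+1 g')%MS.
    apply/row_subP => j; rewrite rowK.
    have -> : g j = g' (lift ord0 j) by rewrite /g' liftK.
    by rewrite -(rowK (fun j => v (g' j))) row_sub.
  have : (mx m.+1 g' <= mx m g)%MS.
    rewrite -(mxrank_leqif_sup le_g) eqn_leq (mxrankS le_g) rkg.
    by apply: maxr; apply/asboolP; exists m.+1, g'.
  apply: submx_trans.
  have -> : v i = row ord0 (mx m.+1 g') by rewrite rowK /g' unlift_none.
  exact: row_sub.
pose X := mx m g; pose ph : 'rV[R]_m := \row_j phi (g j).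
have consist (u : 'rV_m) : u *m X = 0 -> (u *m ph^T) 0 0 = 0.
  move=> uX; rewrite mxE.
  have := phi0 [seq (u 0 j, g j) | j <- index_enum 'I_m].
  rewrite big_map /= => h; rewrite -[RHS]h.
    by apply: eq_bigr => j _; rewrite !mxE.
  move=> w; rewrite /lincomb big_map /=.
  have /rowP/(_ (enum_rank w)) := uX; rewrite !mxE => {2}<-.
  by apply: eq_bigr => j _; rewrite !mxE enum_rankK.
have /submxP[c cE] : (ph <= X *m X^T)%MS.
  rewrite submxE; apply/eqP/matrixP => i j; rewrite ord1 [RHS]mxE.
  pose u := (col j (cokermx (X *m X^T)))^T.
  (* Solvability: a vector killing the Gram matrix kills [X], since [u *m X] has norm zero, and then
     it kills [ph] by the hypothesis on relations. *)
  have uG : u *m X *m X^T = 0.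
    apply: trmx_inj; rewrite !trmx_mul !trmxK mulmxA colE mulmxA mulmx_coker.
    by rewrite mul0mx trmx0.
  have uX : u *m X = 0.
    have e0 : (u *m X) *m (u *m X)^T = 0 by rewrite trmx_mul mulmxA uG mul0mx.
    apply/rowP => k; rewrite [RHS]mxE; apply/eqP.
    have /matrixP/(_ 0 0)/eqP := e0; rewrite mxE [X in _ == X]mxE.
    rewrite psumr_eq0 => [/allP/(_ k (mem_index_enum _))|l _].
      by rewrite /= [in X in _ * X]mxE mulf_eq0 orbb.
    by rewrite [in X in _ * X]mxE -expr2 sqr_ge0.
  have := consist u uX; rewrite !mxE => e; rewrite -[RHS]e.
  by apply: eq_bigr => k _; rewrite !mxE mulrC.
pose K := lincomb [seq (c 0 j, g j) | j <- index_enum 'I_m].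
exists K; first by exists [seq (c 0 j, g j) | j <- index_enum 'I_m].
have KE w : K w = (c *m X) 0 (enum_rank w).
  rewrite /K /lincomb big_map mxE /=.
  by apply: eq_bigr => j _; rewrite !mxE enum_rankK.
move=> i; have /submxP[a aE] := vs i.
have -> : \sum_w K w * x i w = (c *m X *m (v i)^T) 0 0.
  rewrite mxE (reindex (@enum_val W predT)) /=; last by apply: onW_bij; apply: enum_val_bij.
  by apply: eq_bigr => k _; rewrite KE enum_valK !mxE.
rewrite aE trmx_mul mulmxA -[c *m X *m _]mulmxA -cE.
(* The relation expressing generator [i] through the subfamily carries the identity over to [i]. *)
have := phi0 ((1, i) :: [seq (- a 0 j, g j) | j <- index_enum 'I_m]).
rewrite big_cons big_map /= mul1r => h.
apply/esym/eqP; rewrite -subr_eq0 -[X in _ == X]h.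
  rewrite mxE -sumrN; apply/eqP; congr (_ + _).
  by apply: eq_bigr => j _; rewrite !mxE mulNr mulrC.
move=> w; rewrite /lincomb big_cons big_map /= mul1r.
have /rowP/(_ (enum_rank w)) := aE; rewrite !mxE enum_rankK => ->.
rewrite -big_split big1 // => j _ /=.
by rewrite !mxE enum_rankK mulNr subrr.
Qed.

End Span.

(** * Edge structures, tensors and gluing *)

Lemma inj_surj_bij (A B : Type) (g : A -> B) :
  injective g -> (forall y, exists x, g x = y) -> bijective g.
Proof.
move=> g_inj /choice[h hK]; exists h => // x.
by apply: g_inj; rewrite hK.
Qed.

Lemma connect_invariant (T : finType) (U : Type) (r : rel T) (q : T -> U) :
  (forall x y, r x y -> q x = q y) -> forall x y, connect r x y -> q x = q y.
Proof.
move=> rq x y /connectP[p + ->].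
by elim: p x => [//|z p IHp] x /= /andP[/rq -> /IHp].
Qed.

Section JoinFunctions.
Variables (X Y : finType) (n : nat).

Definition fjoin (u : {ffun X -> 'I_n}) (v : {ffun Y -> 'I_n}) :
    {ffun X + Y -> 'I_n} :=
  [ffun z => match z with inl x => u x | inr y => v y end].

Lemma fjoin_bij : bijective (fun p => fjoin p.1 p.2).
Proof.
exists (fun w : {ffun X + Y -> 'I_n} =>
  ([ffun x => w (inl x)], [ffun y => w (inr y)])) => [[u v]|w] /=.
  by congr pair; apply/ffunP => z; rewrite !ffunE.
by apply/ffunP => -[z|z]; rewrite !ffunE.
Qed.

Lemma sum_fjoin (R : nmodType) (F : {ffun X + Y -> 'I_n} -> R) :
  \sum_w F w = \sum_u \sum_v F (fjoin u v).
Proof.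
rewrite pair_big /= (reindex (fun p => fjoin p.1 p.2)) //=.
exact/onW_bij/fjoin_bij.
Qed.

End JoinFunctions.

Lemma ffun_void_all_eq (T : finType) (U : Type) (u v : {ffun T -> U}) :
  (T -> False) -> u = v.
Proof. by move=> T0; apply/ffunP => x; case: (T0 x). Qed.

Lemma sum_ffun_void (R : nmodType) (n : nat) (F : {ffun void -> 'I_n} -> R) w0 :
  \sum_w F w = F w0.
Proof.
rewrite (bigD1 w0) //= big1 ?addr0 // => w.
by rewrite (ffun_void_all_eq w w0 (fun x => match x with end)) eqxx.
Qed.

(** A pairing of the points of [X] into edges, where an edge reached by no point is a circle. Points
    stand for half-edges, for open ends, or for both in a sum type. *)
Record edge_structure (X : finType) := EdgeStructure {
  sedge : finType;
  sedge_of : X -> sedge;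
  sedge_extremities : forall e, #|[set x | sedge_of x == e]| \in [:: 0%N; 2%N]
}.

Section Tensor.
Variables (X : finType) (n : nat).

Definition compatible (P : edge_structure X) (w : {ffun X -> 'I_n})
    (psi : {ffun sedge P -> 'I_n}) : bool :=
  [forall x, psi (sedge_of P x) == w x].

Definition tensor (R : pzRingType) (P : edge_structure X)
    (w : {ffun X -> 'I_n}) : R :=
  #|[set psi | compatible (P := P) w psi]|%:R.

(** Each coloring of the edges is compatible with exactly one [w], the one it induces on the
    points. *)
Lemma sum_tensor (R : pzRingType) (P : edge_structure X)
    (F : {ffun X -> 'I_n} -> R) :
  \sum_w F w * tensor R P w
    = \sum_(psi : {ffun sedge P -> 'I_n}) F [ffun x => psi (sedge_of P x)].
Proof.
under eq_bigr => w _ do rewrite /tensor -sum1dep_card natr_sum big_distrr /=.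
rewrite (exchange_big_dep predT) //=; apply: eq_bigr => psi _.
rewrite (bigD1 [ffun x => psi (sedge_of P x)]) /=; last first.
  by apply/forallP => x; rewrite ffunE.
rewrite mulr1 big1 ?addr0 // => w /andP[/forallP h /eqP[]].
by apply/ffunP => x; rewrite ffunE (eqP (h x)).
Qed.

Lemma tensor_nohalf (R : pzRingType) (P : edge_structure X) w :
  (X -> False) -> tensor R P w = n%:R ^+ #|sedge P|.
Proof.
move=> X0; rewrite -natrX -[X in (X ^ _)%N]card_ord -card_ffun -cardsT; congr (_%:R).
by apply: eq_card => psi; rewrite !inE; apply/forallP => x; case: (X0 x).
Qed.

End Tensor.

Definition pullback (X Y : finType) (g : Y -> X) (bg : bijective g)
  (P : edge_structure X) : edge_structure Y.
Proof.
apply: (@EdgeStructure Y (sedge P) (fun y => sedge_of P (g y))) => e.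
have [h gK hK] := bg; have := sedge_extremities e.
suff -> : #|[set y | sedge_of P (g y) == e]| = #|[set x | sedge_of P x == e]| by [].
rewrite -[RHS](card_imset _ (can_inj hK)); apply: eq_card => y; rewrite inE.
apply/idP/imsetP => [e_y|[x]]; first by exists (g y); rewrite ?inE ?gK.
by rewrite inE => e_x ->; rewrite hK.
Defined.

Lemma tensor_pullback (R : pzRingType) (X Y : finType) (g : Y -> X)
    (bg : bijective g) n (P : edge_structure X) (w : {ffun X -> 'I_n}) :
  tensor R (pullback bg P) [ffun y => w (g y)] = tensor R P w.
Proof.
rewrite /tensor; congr (_%:R); apply: eq_card => psi; rewrite !inE; have [h gK hK] := bg.
apply/forallP/forallP => [H x|H y]; last by rewrite ffunE; apply: H.
by have := H (h x); rewrite ffunE /= hK.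
Qed.

Definition sum_structure (X Y : finType) (P : edge_structure X)
  (Q : edge_structure Y) : edge_structure (X + Y)%type.
Proof.
apply: (@EdgeStructure _ (sedge P + sedge Q)%type
          (sum_map (@sedge_of X P) (@sedge_of Y Q))) => -[] e;
  rewrite card_sum_set.
  rewrite [X in (_ + X)%N]eq_card0 ?addn0; last by move=> y; rewrite inE.
  exact: sedge_extremities.
rewrite [X in (X + _)%N]eq_card0; last by move=> y; rewrite inE.
exact: sedge_extremities.
Defined.

Lemma tensor_sum (R : pzRingType) (X Y : finType) n (P : edge_structure X)
    (Q : edge_structure Y) (u : {ffun X -> 'I_n}) (v : {ffun Y -> 'I_n}) :
  tensor R (sum_structure P Q) (fjoin u v) = tensor R P u * tensor R Q v.
Proof.
rewrite /tensor -natrM; congr (_%:R); rewrite -cardsX.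
have [h hK Kh] := fjoin_bij (sedge P) (sedge Q) n.
rewrite -(card_imset _ (can_inj hK)) /=.
apply: eq_card => psi; rewrite !inE; apply/forallP/imsetP => [H|[[p q]]].
  exists (h psi); rewrite ?Kh // !inE.
  apply/andP; split; apply/forallP => x.
    by have := H (inl x); rewrite -[psi]Kh hK !ffunE.
  by have := H (inr x); rewrite -[psi]Kh hK !ffunE.
rewrite !inE /= => /andP[/forallP Hp /forallP Hq] -> [x|y]; rewrite !ffunE.
  exact: Hp.
exact: Hq.
Qed.

(** Turns all points of [X] into open ends of a fragment that has no half-edges. *)
Definition right_structure (X : finType) (P : edge_structure X) :
  edge_structure (void + X)%type.
Proof.
apply: (@EdgeStructure _ (sedge P) (fun z : void + X =>
  match z with inl o => match o with end | inr x => sedge_of P x end)) => e.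
 rewrite card_sum_set eq_card0; last by case.
exact: sedge_extremities.
Defined.

Lemma tensor_right (R : pzRingType) (X : finType) n (P : edge_structure X)
    (u : {ffun void -> 'I_n}) (v : {ffun X -> 'I_n}) :
  tensor R (right_structure P) (fjoin u v) = tensor R P v.
Proof.
rewrite /tensor; congr (_%:R); apply: eq_card => psi; rewrite !inE.
apply/forallP/forallP => [H x|H [[]|x]]; last by rewrite ffunE; apply: H.
by have := H (inr x); rewrite ffunE.
Qed.

(** The perfect matching of [inl x] with [inr (s x)]; an edge is named by its right end. *)
Definition perm_structure (X : finType) (s : {perm X}) : edge_structure (X + X)%type.
Proof.
apply: (@EdgeStructure _ X (fun z : X + X =>
  match z with inl x => s x | inr x => x end)) => e.
 rewrite card_sum_set.
rewrite (_ : [set a | s a == e] = [set (s^-1)%g e]); last first.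
  by apply/setP => x; rewrite !inE (canF_eq (permK s)).
by rewrite cards1 (_ : [set b | b == e] = [set e]) ?cards1 //; apply/setP => x; rewrite !inE.
Defined.

Lemma tensor_perm (R : pzRingType) (X : finType) n (s : {perm X})
    (u v : {ffun X -> 'I_n}) :
  tensor R (perm_structure s) (fjoin u v) = [forall x, u x == v (s x)]%:R.
Proof.
rewrite /tensor; congr (_%:R).
case: (boolP [forall x, u x == v (s x)]) => [/forallP H|H].
  transitivity #|[set v]|; last by rewrite cards1.
  apply: eq_card => psi; rewrite !inE; apply/forallP/eqP => [Hp|->].
    by apply/ffunP => x; have := Hp (inr x); rewrite ffunE => /eqP.
  by case=> x; rewrite ffunE // eq_sym; apply: H.
apply: eq_card0 => psi; rewrite !inE; apply: contraNF H => /forallP Hp.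
apply/forallP => x; have := Hp (inl x); have := Hp (inr (s x)).
by rewrite !ffunE /= => /eqP-> /eqP->.
Qed.

Definition mkgraph (V X : finType) (vm : X -> V) (P : edge_structure X) : graph.
Proof.
apply: (@Fragment 0 V (sedge P) X vm (@sedge_of X P) (@ord0_elim _)) => e.
by rewrite card_ord0_set addn0; apply: sedge_extremities.
Defined.

Definition structure_of (G : graph) : edge_structure (halfedge G).
Proof.
apply: (@EdgeStructure _ (edge G) (@edge_of 0 G)) => e.
by have := edge_extremities e; rewrite card_ord0_set addn0.
Defined.

Lemma mkgraph_structure (G : graph) :
  isomorphic (mkgraph (@vertex_of 0 G) (structure_of G)) G.
Proof.
exists id, id, id; split; try exact: inv_bij; rewrite //=.
by split=> // -[].
Qed.

(** The points in [X] become half-edges and those in [Y] open ends, labelled through the enumeration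
    of [Y]. Two fragments with the same [Y] can thus be glued. *)
Definition mkfragment (V X Y : finType) (vm : X -> V)
  (P : edge_structure (X + Y)%type) : fragment #|Y|.
Proof.
apply: (@Fragment #|Y| V (sedge P) X vm (fun x => sedge_of P (inl x))
         (fun i => sedge_of P (inr (enum_val i)))) => e.
have := sedge_extremities e; rewrite card_sum_set.
suff -> : #|[set i : 'I_#|Y| | sedge_of P (inr (enum_val i)) == e]|
  = #|[set y | sedge_of P (inr y) == e]| by [].
rewrite -[RHS](card_imset _ enum_rank_inj); apply: eq_card => i; rewrite !inE.
apply/idP/imsetP => [H|[y]]; last by rewrite inE => H ->; rewrite enum_rankK.
by exists (enum_val i); rewrite ?inE ?enum_valK.
Defined.

Section Glue.
Variables (k : nat) (F1 F2 : fragment k).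

Lemma glue_class_eq x y :
  (glue_class x == glue_class y :> glue_edge F1 F2)
    = connect (@glue_rel k F1 F2) x y.
Proof. by rewrite -val_eqE /= root_connect //; apply: glue_connect_sym. Qed.

Lemma glue_class_val (e : glue_edge F1 F2) : glue_class (val e) = e.
Proof. by apply/val_inj/eqP; have := valP e. Qed.

Lemma glue_open i : connect (@glue_rel k F1 F2)
  (inl (open_edge F1 i)) (inr (open_edge F2 i)).
Proof. by apply/connect1/existsP; exists i; rewrite !eqxx. Qed.

Lemma glue_invariant (U : Type) (q : edge F1 + edge F2 -> U) :
  (forall i, q (inl (open_edge F1 i)) = q (inr (open_edge F2 i))) ->
  forall x y, connect (@glue_rel k F1 F2) x y -> q x = q y.
Proof.
move=> H; apply: connect_invariant => x y /existsP[i].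
by case/orP=> /andP[/eqP-> /eqP->].
Qed.

(** Recognizes a glued graph without handling canonical roots: it suffices to give a map [q] on the
    edges before gluing whose fibres are exactly the chains. *)
Lemma glue_isomorphic (G : graph)
    (fV : vertex F1 + vertex F2 -> vertex G)
    (fH : halfedge F1 + halfedge F2 -> halfedge G)
    (q : edge F1 + edge F2 -> edge G) :
  bijective fV -> bijective fH -> (forall e, exists x, q x = e) ->
  (forall i, q (inl (open_edge F1 i)) = q (inr (open_edge F2 i))) ->
  (forall x y, q x = q y -> connect (@glue_rel k F1 F2) x y) ->
  (forall h, vertex_of (fH h)
     = fV (sum_map (@vertex_of k F1) (@vertex_of k F2) h)) ->
  (forall h, edge_of (fH h)
     = q (sum_map (@edge_of k F1) (@edge_of k F2) h)) ->
  isomorphic (glue F1 F2) G.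
Proof.
move=> bV bH q_surj q_open q_inj HV HE.
have qc x : q (val (glue_class x : glue_edge F1 F2)) = q x.
  apply: (glue_invariant q_open); rewrite -glue_class_eq; apply/eqP.
  exact: glue_class_val.
exists fV, (fun e : glue_edge F1 F2 => q (val e)), fH; split=> //.
  apply: inj_surj_bij => [e e' /q_inj|e].
    by rewrite -glue_class_eq !glue_class_val => /eqP.
  by have [x <-] := q_surj e; exists (glue_class x).
by split=> [h|[]//]; rewrite HE [RHS]qc.
Qed.

End Glue.

(** A coloring of the glued edges is a pair of colorings of the two sides that agree at the
    identified open ends; [u] records their common colors there. *)
Lemma tensor_glue (R : pzRingType) (n : nat) (V1 V2 X1 X2 Y : finType)
    (vm1 : X1 -> V1) (vm2 : X2 -> V2)
    (P1 : edge_structure (X1 + Y)%type) (P2 : edge_structure (X2 + Y)%type)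
    (w1 : {ffun X1 -> 'I_n}) (w2 : {ffun X2 -> 'I_n}) :
  tensor R (structure_of (glue (mkfragment vm1 P1) (mkfragment vm2 P2)))
      (fjoin w1 w2)
    = \sum_(u : {ffun Y -> 'I_n})
        tensor R P1 (fjoin w1 u) * tensor R P2 (fjoin w2 u).
Proof.
set F1 := mkfragment vm1 P1; set F2 := mkfragment vm2 P2.
under eq_bigr => u _ do rewrite /tensor -natrM -cardsX.
rewrite -natr_sum /tensor; congr (_%:R).
pose A := [set p : {ffun sedge P1 -> 'I_n} * {ffun sedge P2 -> 'I_n} |
  [&& [forall x, p.1 (sedge_of P1 (inl x)) == w1 x],
      [forall x, p.2 (sedge_of P2 (inl x)) == w2 x]
    & [forall y, p.1 (sedge_of P1 (inr y)) == p.2 (sedge_of P2 (inr y))]]].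
transitivity #|A|; last first.
  pose op (p : {ffun sedge P1 -> 'I_n} * {ffun sedge P2 -> 'I_n}) :
    {ffun Y -> 'I_n} := [ffun y => p.1 (sedge_of P1 (inr y))].
  rewrite -sum1_card (partition_big op predT) //=; apply: eq_bigr => u _.
  rewrite sum1dep_card; apply: eq_card => -[p1 p2]; rewrite !inE /=.
  apply/andP/andP => [[/and3P[/forallP h1 /forallP h2 /forallP h3] /eqP <-]|
                      [/forallP h1 /forallP h2]].
    split; apply/forallP => -[x|y]; rewrite ?ffunE ?h1 ?h2 //.
    by rewrite eq_sym h3.
  split; first (apply/and3P; split).
  - by apply/forallP => x; have := h1 (inl x); rewrite ffunE.
  - by apply/forallP => x; have := h2 (inl x); rewrite ffunE.
  - apply/forallP => y; have := h1 (inr y); have := h2 (inr y).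
    by rewrite !ffunE => /eqP-> /eqP->.
  - apply/eqP/ffunP => y; rewrite ffunE /=.
    by have := h1 (inr y); rewrite ffunE => /eqP.
(* Restriction of a coloring of chains to the edges of each side; its image on compatible colorings
   is [A]. *)
pose Phi (psi : {ffun glue_edge F1 F2 -> 'I_n}) :=
  ([ffun e : sedge P1 => psi (@glue_class _ F1 F2 (inl e))],
   [ffun e : sedge P2 => psi (@glue_class _ F1 F2 (inr e))]).
have Phi_inj : injective Phi.
  move=> p p' [/ffunP h1 /ffunP h2]; apply/ffunP => e; rewrite -(glue_class_val e).
  by case: (val e) => e'; [have := h1 e'|have := h2 e']; rewrite !ffunE.
rewrite -(card_imset _ Phi_inj); apply: eq_card => -[p1 p2].
apply/imsetP/idP => [[psi] | ].
  rewrite !inE => /forallP h [-> ->] /=; apply/and3P; split; apply/forallP => x.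
  - by rewrite ffunE; have := h (inl x); rewrite ffunE.
  - by rewrite ffunE; have := h (inr x); rewrite ffunE.
  - rewrite !ffunE; apply/eqP; congr (psi _); apply/eqP; rewrite glue_class_eq.
    by have := @glue_open _ F1 F2 (enum_rank x); rewrite /= enum_rankK.
rewrite inE /= => /and3P[/forallP h1 /forallP h2 /forallP h3].
pose q (x : edge F1 + edge F2) :=
  match x with inl e => p1 e | inr e => p2 e end.
have q_inv : forall x y, connect (@glue_rel _ F1 F2) x y -> q x = q y.
  by apply: glue_invariant => i /=; apply/eqP/h3.
pose psi := [ffun e : glue_edge F1 F2 => q (val e)].
have psiE x : psi (glue_class x) = q x.
  rewrite ffunE; apply: q_inv; rewrite -glue_class_eq; apply/eqP.
  exact: glue_class_val.
exists psi; last by congr pair; apply/ffunP => e; rewrite ffunE psiE.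
rewrite inE; apply/forallP => -[x|x]; rewrite [X in _ == X]ffunE.
  exact/eqP/(etrans (psiE (inl (sedge_of P1 (inl x)))))/eqP/h1.
exact/eqP/(etrans (psiE (inr (sedge_of P2 (inl x)))))/eqP/h2.
Qed.

(** * The value of the circle *)

Lemma eq_card_bij (A B : finType) :
  #|A| = #|B| -> exists g : A -> B, bijective g.
Proof.
move=> eqAB; exists (fun x => enum_val (cast_ord eqAB (enum_rank x))).
exists (fun y => enum_val (cast_ord (esym eqAB) (enum_rank y))) => x.
  by rewrite enum_valK cast_ordK enum_rankK.
by rewrite enum_valK cast_ordKV enum_rankK.
Qed.

Definition void_structure (E : finType) : edge_structure void.
Proof.
by apply: (@EdgeStructure void E (fun x => match x with end)) => e; rewrite eq_card0.
Defined.

Definition circles (E : finType) : graph := mkgraph (@id void) (void_structure E).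

Lemma vertexless_isomorphic (G H : graph) :
  (vertex G -> False) -> (halfedge G -> False) ->
  (vertex H -> False) -> (halfedge H -> False) ->
  #|edge G| = #|edge H| -> isomorphic G H.
Proof.
move=> vG hG vH hH /eq_card_bij[g bg].
exists (fun v => match vG v with end), g, (fun h => match hG h with end).
split=> //; try by [move=> h; case: (hG h)].
- by exists (fun v => match vH v with end) => v; [case: (vG v)|case: (vH v)].
- by exists (fun v => match hH v with end) => v; [case: (hG v)|case: (hH v)].
- by split=> [h|[]//]; case: (hG h).
Qed.

Lemma quantum_eval_glue (R : realType) (f : graph -> R) k (Q1 Q2 : quantum R k) :
  quantum_eval f (quantum_glue Q1 Q2)
    = \sum_(p <- Q1) \sum_(q <- Q2) p.1 * q.1 * f (glue p.2 q.2).
Proof. by rewrite /quantum_eval /quantum_glue big_allpairs_dep. Qed.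

Definition vertexless_fragment (X : finType) (P : edge_structure X) :
    fragment #|X| :=
  mkfragment (@id void) (right_structure P).

(** The glued graph consists of circles only, which are colored independently. Here [n] is any
    number of colors, not yet linked to [f]. *)
Lemma vertexless_glue_colorings (R : pzRingType) n (X : finType)
    (P Q : edge_structure X) :
  n%:R ^+ #|edge (glue (vertexless_fragment P) (vertexless_fragment Q))|
    = \sum_(u : {ffun X -> 'I_n}) tensor R P u * tensor R Q u.
Proof.
pose w : {ffun void -> 'I_n} := [ffun x : void => match x with end].
have := @tensor_glue R n _ _ _ _ _ (@id void) (@id void)
  (right_structure P) (right_structure Q) w w.
rewrite tensor_nohalf; last by case=> -[].
by move=> ->; apply: eq_bigr => u _; rewrite !tensor_right.
Qed.

Section Circle.
Variables (R : realType) (f : graph -> R).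
Hypotheses (f_param : graph_parameter f) (f_rp : edge_reflection_positive f)
  (f_mult : Defs.multiplicative f).

Lemma f_vertexless (G : graph) : (vertex G -> False) -> (halfedge G -> False) ->
  f G = f (circles unit) ^+ #|edge G|.
Proof.
move=> vG hG; have -> : f G = f (circles 'I_#|edge G|).
  by apply: f_param; apply: vertexless_isomorphic => //; try case; rewrite card_ord.
have [fU f0] := f_mult.
elim: #|edge G| => [|n IHn].
  rewrite expr0 -f0; apply: f_param.
  by apply: vertexless_isomorphic => //; try case; rewrite card_ord card_void.
rewrite exprS -IHn -fU; apply: f_param.
apply: vertexless_isomorphic => //; try by [case | case; case].
by rewrite card_ord card_sum card_unit card_ord.
Qed.

Lemma f_vertexless_glue (X : finType) (P Q : edge_structure X) :
  f (glue (vertexless_fragment P) (vertexless_fragment Q)) =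
  f (circles unit) ^+ #|edge (glue (vertexless_fragment P) (vertexless_fragment Q))|.
Proof. by apply: f_vertexless => -[[]|[]]. Qed.

(** At the value of the circle this is [f] of the signed sum of all matchings glued with itself. At
    [n%:R] it counts colorings with [n] colors, which gives access to its roots. *)
Definition antisymmetrizer_poly k : {poly R} :=
  \sum_(s : {perm 'I_k}) \sum_(t : {perm 'I_k}) ((-1) ^+ s * (-1) ^+ t) *:
    'X^#|edge (glue (vertexless_fragment (perm_structure s))
                    (vertexless_fragment (perm_structure t)))|.

Lemma antisymmetrizer_poly_ge0 k :
  0 <= (antisymmetrizer_poly k).[f (circles unit)].
Proof.
pose F (s : {perm 'I_k}) := ((-1) ^+ s : R, vertexless_fragment (perm_structure s)).
have := f_rp [seq F s | s <- index_enum {perm 'I_k}].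
rewrite quantum_eval_glue big_map => h.
rewrite (le_trans h) // le_eqVlt; apply/orP; left; apply/eqP.
rewrite /antisymmetrizer_poly horner_sum; apply: eq_bigr => s _.
rewrite big_map horner_sum; apply: eq_bigr => t _.
by rewrite hornerZ hornerXn f_vertexless_glue.
Qed.

(** This is the Leibniz formula. *)
Lemma antisymmetrized_tensor k n (u v : {ffun 'I_k -> 'I_n}) :
  \sum_(s : {perm 'I_k}) (-1) ^+ s * tensor R (perm_structure s) (fjoin u v)
    = \det (\matrix_(i, j) (u i == v j)%:R).
Proof.
rewrite /determinant; apply: eq_bigr => s _; congr (_ * _).
rewrite tensor_perm.
have [/forallP H|] := boolP [forall x, u x == v (s x)].
  by rewrite mulr1n big1 // => i _; rewrite mxE H.
rewrite negb_forall => /existsP[i /negbTE ui].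
by rewrite mulr0n (bigD1 i isT) /= mxE ui mulr0n mul0r.
Qed.

Lemma antisymmetrized_sum k n (N : {perm 'I_k} -> {perm 'I_k} -> nat) :
  (forall s t, n%:R ^+ N s t = \sum_(w : {ffun 'I_k + 'I_k -> 'I_n})
     tensor R (perm_structure s) w * tensor R (perm_structure t) w) ->
  (\sum_(s : {perm 'I_k}) \sum_(t : {perm 'I_k})
     ((-1) ^+ s * (-1) ^+ t) *: 'X^(N s t) : {poly R}).[n%:R] =
  \sum_(u : {ffun 'I_k -> 'I_n}) \sum_(v : {ffun 'I_k -> 'I_n})
    (\det (\matrix_(i, j) (u i == v j)%:R : 'M[R]_k)) ^+ 2.
Proof.
move=> HN.
under [RHS]eq_bigr => u _ do
  under eq_bigr => v _ do rewrite -antisymmetrized_tensor.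
rewrite -(sum_fjoin (fun w => (\sum_(s : {perm 'I_k})
  (-1) ^+ s * tensor R (perm_structure s) w) ^+ 2)).
under [RHS]eq_bigr => w _ do rewrite expr2 big_distrlr /=.
rewrite [RHS]exchange_big horner_sum; apply: eq_bigr => s _ /=.
rewrite [RHS]exchange_big horner_sum; apply: eq_bigr => t _ /=.
rewrite hornerZ hornerXn HN big_distrr /=.
by apply: eq_bigr => w _; rewrite mulrACA.
Qed.

Lemma antisymmetrizer_poly_nat k n :
  (antisymmetrizer_poly k).[n%:R] =
  \sum_(u : {ffun 'I_k -> 'I_n}) \sum_(v : {ffun 'I_k -> 'I_n})
    (\det (\matrix_(i, j) (u i == v j)%:R)) ^+ 2.
Proof.
by apply: antisymmetrized_sum => s t; apply: vertexless_glue_colorings.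
Qed.

(** With fewer than [k] colors, [u] repeats a color and the determinant has two equal rows. *)
Lemma antisymmetrizer_poly_root k n : (n < k)%N ->
  (antisymmetrizer_poly k).[n%:R] = 0.
Proof.
move=> lt_nk; rewrite antisymmetrizer_poly_nat big1 // => u _; rewrite big1 // => v _.
have /injectivePn[i [j ij uij]] : ~~ injectiveb u.
  apply: contraL lt_nk => /injectiveP /leq_card; rewrite !card_ord.
  by rewrite leqNgt.
by rewrite (determinant_alternate ij) ?expr0n // => l; rewrite !mxE uij.
Qed.

(** Taking the identity for both [u] and [v] yields the determinant of the identity matrix; all
    other terms are squares. *)
Lemma antisymmetrizer_poly_pos k : 0 < (antisymmetrizer_poly k).[k%:R].
Proof.
rewrite antisymmetrizer_poly_nat.
have S0 u : 0 <= \sum_(v : {ffun 'I_k -> 'I_k})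
    (\det (\matrix_(i, j) ((u : {ffun 'I_k -> 'I_k}) i == v j)%:R : 'M[R]_k)) ^+ 2.
  by apply: sumr_ge0 => v _; apply: sqr_ge0.
rewrite (bigD1 [ffun i => i]) //= ltr_wpDr ?sumr_ge0 //.
rewrite (bigD1 [ffun i => i]) //= ltr_wpDr //.
  by apply: sumr_ge0 => v _; apply: sqr_ge0.
rewrite (_ : \matrix_(i, j) _ = 1%:M) ?det1 ?expr1n ?ltr01 //.
by apply/matrixP => i j; rewrite !mxE !ffunE.
Qed.

(** Every circle of the glued graph passes through one of the [k] edges of the left fragment. *)
Lemma size_antisymmetrizer_poly k : (size (antisymmetrizer_poly k) <= k.+1)%N.
Proof.
apply: (leq_trans (size_sum _ _ _)); apply/bigmax_leqP => s _.
apply: (leq_trans (size_sum _ _ _)); apply/bigmax_leqP => t _.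
apply: (leq_trans (size_scale_leq _ _)); rewrite size_polyXn ltnS.
set F1 := vertexless_fragment _; set F2 := vertexless_fragment _.
pose g (e : 'I_k) : glue_edge F1 F2 := @glue_class _ F1 F2 (inl e).
rewrite -[X in (_ <= X)%N](card_ord k).
apply: (leq_trans _ (leq_image_card g _)); apply: subset_leq_card.
apply/subsetP => e _; rewrite -(glue_class_val e).
case: (val e) => e'; first exact: image_f.
have /eqP <- : glue_class (inl (open_edge F1 (enum_rank (inr e'))))
    == glue_class (inr e') :> glue_edge F1 F2.
  rewrite glue_class_eq.
  by have := @glue_open _ F1 F2 (enum_rank (inr e')); rewrite /= enum_rankK.
exact: image_f.
Qed.

(** The polynomial has degree at most [k] and the roots [0, ..., k - 1], so it is a multiple of the
    falling product; its positivity at [k] makes the factor positive. *)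
Lemma falling_product_circle_ge0 k :
  0 <= \prod_(i < k) (f (circles unit) - i%:R).
Proof.
set p := antisymmetrizer_poly k; pose rs : seq R := [seq i%:R | i <- iota 0 k].
have rsE x : (\prod_(z <- rs) ('X - z%:P)).[x] = \prod_(i < k) (x - i%:R).
  rewrite horner_prod big_map -(big_mkord xpredT (fun i => x - i%:R)) /index_iota subn0.
  by apply: eq_bigr => i _; rewrite !hornerE.
have uniq_rs : uniq rs.
  by rewrite map_inj_uniq ?iota_uniq //; apply: mulrIn; rewrite oner_eq0.
have p_gt0 := antisymmetrizer_poly_pos k.
have p_neq0 : p != 0 by apply: contraTneq p_gt0 => p0; rewrite -/p p0 horner0 ltxx.
have root_rs : all (root p) rs.
  apply/allP => x /mapP[i]; rewrite mem_iota add0n => /andP[_ ik] ->.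
  by apply/rootP; apply: antisymmetrizer_poly_root.
have size_p : size p = (size rs).+1.
  apply/eqP; rewrite eqn_leq (max_poly_roots p_neq0 root_rs uniq_rs) andbT.
  by rewrite size_map size_iota; apply: size_antisymmetrizer_poly.
have pE := all_roots_prod_XsubC size_p root_rs.
rewrite uniq_rootsE in pE; have {}pE := pE uniq_rs.
have c_gt0 : 0 < lead_coef p.
  have : 0 < \prod_(i < k) (k%:R - i%:R : R).
    by apply: prodr_gt0 => i _; rewrite subr_gt0 ltr_nat.
  by move=> h; move: p_gt0; rewrite -/p pE hornerZ rsE pmulr_lgt0 -?pE.
by have := antisymmetrizer_poly_ge0 k; rewrite -/p pE hornerZ rsE pmulr_rge0.
Qed.

Lemma circle_nat : exists d : nat, f (circles unit) = d%:R.
Proof.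
set x := f _; have x_ge0 : 0 <= x.
  by have := falling_product_circle_ge0 1; rewrite big_ord1 subr0.
exists (Num.truncn x); apply/eqP; have /andP[le_x lt_x] := truncn_itv x_ge0.
rewrite eq_le le_x andbT leNgt; apply/negP => lt_mx.
(* For [x] strictly between [m] and [m + 1], only the last of these [m + 2] factors is negative. *)
have := falling_product_circle_ge0 (Num.truncn x).+2; rewrite -/x big_ord_recr /=.
apply/negP; rewrite -ltNge pmulr_rlt0 ?subr_lt0 //.
apply: prodr_gt0 => i _; rewrite subr_gt0; apply: le_lt_trans lt_mx.
by rewrite ler_nat -ltnS.
Qed.

End Circle.

(** * The representing tensor *)

Section TensorSpan.
Variables (R : realType) (d : nat).

Definition tensor_span (X : finType) (a : {ffun X -> 'I_d} -> R) :=
  in_span (fun P : edge_structure X => tensor R P) a.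

Definition fleft (X Y : finType) (w : {ffun X + Y -> 'I_d}) : {ffun X -> 'I_d} :=
  [ffun x => w (inl x)].
Definition fright (X Y : finType) (w : {ffun X + Y -> 'I_d}) : {ffun Y -> 'I_d} :=
  [ffun y => w (inr y)].

Lemma fleft_fjoin (X Y : finType) (u : {ffun X -> 'I_d}) (v : {ffun Y -> 'I_d}) :
  fleft (fjoin u v) = u.
Proof. by apply/ffunP => x; rewrite !ffunE. Qed.

Lemma fright_fjoin (X Y : finType) (u : {ffun X -> 'I_d}) (v : {ffun Y -> 'I_d}) :
  fright (fjoin u v) = v.
Proof. by apply/ffunP => x; rewrite !ffunE. Qed.

Lemma fjoin_fleft_fright (X Y : finType) (w : {ffun X + Y -> 'I_d}) :
  fjoin (fleft w) (fright w) = w.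
Proof. by apply/ffunP => -[x|y]; rewrite !ffunE. Qed.

(** Contraction along [Y] is gluing along [Y]. Tensors do not see vertices, so each half-edge is
    taken as its own vertex. *)
Lemma tensor_span_contract (X1 X2 Y : finType)
    (a : {ffun X1 + Y -> 'I_d} -> R) (b : {ffun X2 + Y -> 'I_d} -> R) :
  tensor_span a -> tensor_span b ->
  tensor_span (fun w : {ffun X1 + X2 -> 'I_d} =>
    \sum_u a (fjoin (fleft w) u) * b (fjoin (fright w) u)).
Proof.
move=> [s sa] [t tb].
pose G (p : R * edge_structure (X1 + Y)%type) (q : R * edge_structure (X2 + Y)%type) :=
  structure_of (glue (mkfragment id p.2) (mkfragment id q.2)).
apply: (@in_span_ext _ _ _ _ (fun w : {ffun X1 + X2 -> 'I_d} =>
  \sum_(p <- s) \sum_(q <- t) p.1 * q.1 * tensor R (G p q) w)).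
  move=> w; under [RHS]eq_bigr => u _ do rewrite sa tb /lincomb big_distrlr /=.
  rewrite exchange_sum_seq; apply: eq_bigr => p _ /=.
  rewrite exchange_sum_seq; apply: eq_bigr => q _ /=.
  rewrite -{1}[w]fjoin_fleft_fright tensor_glue big_distrr /=.
  by apply: eq_bigr => u _; rewrite mulrACA.
apply: in_span_sum => p _; apply: in_span_sum => q _; apply: in_spanZ.
exact: (in_span_gen (fun P : edge_structure (X1 + X2)%type => tensor R P) (G p q)).
Qed.

Lemma tensor_span_reindex (X X' : finType) (g : X' -> X) a :
  bijective g -> tensor_span a ->
  tensor_span (fun w : {ffun X -> 'I_d} => a [ffun x => w (g x)]).
Proof.
move=> [h gK hK] [s sa].
have bh : bijective h by exists g.
apply: (@in_span_ext _ _ _ _ (fun w : {ffun X -> 'I_d} =>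
  \sum_(p <- s) p.1 * tensor R (pullback bh p.2) w)).
  move=> w; rewrite sa; apply: eq_bigr => p _; congr (_ * _).
  rewrite -[RHS](tensor_pullback R bh); congr tensor.
  by apply/ffunP => x; rewrite !ffunE hK.
apply: in_span_sum => p _; apply: in_spanZ.
exact: (in_span_gen (fun P : edge_structure X => tensor R P)).
Qed.

Lemma tensor_span_contract_left (X Y : finType) (a : {ffun Y + X -> 'I_d} -> R)
    (P : edge_structure Y) : tensor_span a ->
  tensor_span (fun w => \sum_u a (fjoin u w) * tensor R P u).
Proof.
move=> sa.
have sw : tensor_span (fun w : {ffun X + Y -> 'I_d} => a (fjoin (fright w) (fleft w))).
  pose g (z : Y + X) : X + Y := match z with inl y => inr y | inr x => inl x end.
  have bg : bijective g.
    by exists (fun z => match z with inl y => inr y | inr x => inl x end) => -[].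
  apply: in_span_ext (tensor_span_reindex bg sa) => w; congr a.
  by apply/ffunP => -[x|x]; rewrite !ffunE.
have sP : tensor_span (fun w : {ffun void + Y -> 'I_d} => tensor R (right_structure P) w).
  exact: (in_span_gen (fun P : edge_structure (void + Y)%type => tensor R P)).
pose g (z : X + void) : X := match z with inl x => x | inr o => match o with end end.
have bg : bijective g by exists inl => // -[x|[]].
apply: in_span_ext (tensor_span_reindex bg (tensor_span_contract sw sP)) => w.
apply: eq_bigr => u _; rewrite tensor_right fleft_fjoin fright_fjoin; congr (a (fjoin _ _) * _).
by apply/ffunP => x; rewrite !ffunE.
Qed.

End TensorSpan.

Section Kernel.
Variables (R : realType) (f : graph -> R).
Hypotheses (f_param : graph_parameter f) (f_rp : edge_reflection_positive f)
  (f_mult : Defs.multiplicative f).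
Variables (d : nat) (f_circle : f (circles unit) = d%:R).

(** Every half-edge runs to its own open end, so gluing with a vertexless fragment lets the latter
    decide how the half-edges are paired. *)
Definition star (V X : finType) (vm : X -> V) : fragment #|X| :=
  mkfragment vm (perm_structure (1%g : {perm X})).

Lemma f_glue_star (V X : finType) (vm : X -> V) (P : edge_structure X) :
  f (glue (star vm) (vertexless_fragment P)) = f (mkgraph vm P).
Proof.
apply: f_param; set F1 := star vm; set F2 := vertexless_fragment P.
pose q (z : edge F1 + edge F2) : sedge P :=
  match z with inl x => sedge_of P x | inr e => e end.
have q_conn z : connect (@glue_rel _ F1 F2) z (inr (q z)).
  case: z => [x|e] /=; last exact: connect0.
  by have := @glue_open _ F1 F2 (enum_rank x); rewrite /= enum_rankK.
apply: (@glue_isomorphic _ F1 F2 (mkgraph vm P)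
  (fun z => match z with inl v => v | inr o => match o with end end)
  (fun z => match z with inl x => x | inr o => match o with end end) q).
- by exists inl => // -[x|[]].
- by exists inl => // -[x|[]].
- by move=> e; exists (inr e).
- by [].
- move=> x y xy; apply: connect_trans (q_conn x) _.
  by rewrite glue_connect_sym xy; apply: q_conn.
- by case=> [x|[]].
- by case=> [x|[]] //=; rewrite perm1.
Qed.

Lemma f_glue_star_sym (V X : finType) (vm : X -> V) (P : edge_structure X) :
  f (glue (vertexless_fragment P) (star vm)) = f (mkgraph vm P).
Proof.
apply: f_param; set F2 := star vm; set F1 := vertexless_fragment P.
pose q (z : edge F1 + edge F2) : sedge P :=
  match z with inr x => sedge_of P x | inl e => e end.
have q_conn z : connect (@glue_rel _ F1 F2) z (inl (q z)).
  case: z => [e|x]; first exact: connect0.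
  rewrite glue_connect_sym /=.
  by have := @glue_open _ F1 F2 (enum_rank x); rewrite /= enum_rankK.
apply: (@glue_isomorphic _ F1 F2 (mkgraph vm P)
  (fun z => match z with inr v => v | inl o => match o with end end)
  (fun z => match z with inr x => x | inl o => match o with end end) q).
- by exists inr => // -[[]|x].
- by exists inr => // -[[]|x].
- by move=> e; exists (inl e).
- by [].
- move=> x y xy; apply: connect_trans (q_conn x) _.
  by rewrite glue_connect_sym xy; apply: q_conn.
- by case=> [[]|x].
- by case=> [[]|x] //=; rewrite perm1.
Qed.

(** Because the circle is worth [d], gluing vertexless fragments is the standard inner product of
    their tensors in [d] colors. *)
Lemma f_vertexless_glue_tensor (X : finType) (P Q : edge_structure X) :
  f (glue (vertexless_fragment P) (vertexless_fragment Q))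
    = \sum_(u : {ffun X -> 'I_d}) tensor R P u * tensor R Q u.
Proof.
by rewrite f_vertexless_glue // f_circle vertexless_glue_colorings.
Qed.

(* Cauchy-Schwarz for the form [f (glue _ _)], tested against the star. *)
Lemma f_tensor_relation (V X : finType) (vm : X -> V)
    (s : seq (R * edge_structure X)) :
  (forall w : {ffun X -> 'I_d},
     lincomb (fun P : edge_structure X => tensor R P) s w = 0) ->
  \sum_(p <- s) p.1 * f (mkgraph vm p.2) = 0.
Proof.
move=> s0; set a := \sum_(p <- s) _.
set c := f (glue (star vm) (star vm)).
have form_ge0 l : 0 <= c + 2 * l * a.
  have := f_rp ((1, star vm) ::
    [seq (l * p.1, vertexless_fragment p.2) | p <- s]).
  rewrite quantum_eval_glue !big_cons big_map big_map /= !mul1r -/c.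
  under [X in _ + X]eq_bigr => p _ do rewrite big_cons /=.
  have -> : \sum_(p <- s) 1 * (l * p.1) * f (glue (star vm) (vertexless_fragment p.2))
      = l * a.
    by rewrite big_distrr /=; apply: eq_bigr => p _; rewrite mul1r f_glue_star mulrA.
  have -> : \sum_(p <- s) (l * p.1 * 1 * f (glue (vertexless_fragment p.2) (star vm)) +
      \sum_(q <- [seq (l * p0.1, vertexless_fragment p0.2) | p0 <- s])
        l * p.1 * q.1 * f (glue (vertexless_fragment p.2) q.2)) = l * a.
    rewrite big_split /= [X in _ + X](_ : _ = 0) ?addr0.
      by rewrite big_distrr /=; apply: eq_bigr => p _; rewrite mulr1 f_glue_star_sym mulrA.
    under eq_bigr => p _ do rewrite big_map /=.
    transitivity (\sum_(w : {ffun X -> 'I_d})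
      (l * lincomb (fun P : edge_structure X => tensor R P) s w) ^+ 2).
      under [RHS]eq_bigr => w _ do
        rewrite exprMn [X in _ * X]expr2 /lincomb big_distrlr big_distrr /=.
      rewrite exchange_sum_seq; apply: eq_bigr => p _ /=.
      under [RHS]eq_bigr => w _ do rewrite big_distrr /=.
      rewrite exchange_sum_seq; apply: eq_bigr => q _ /=.
      rewrite f_vertexless_glue_tensor big_distrr /=; apply: eq_bigr => w _.
      by move: (tensor R p.2 w) (tensor R q.2 w) => x y; ring.
    by rewrite big1 // => w _; rewrite s0 mulr0 expr0n.
  by move=> h; apply: (le_trans h); rewrite -addrA lerD2l; lra.
(* The form is affine in [l], its quadratic term being zero; this choice of [l] gives it the value
   [- 1]. *)
apply/eqP/negPn/negP => a0; have := form_ge0 (- (c + 1) / (2 * a)).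
have -> : 2 * (- (c + 1) / (2 * a)) * a = - (c + 1) by field.
lra.
Qed.

Lemma kernel_exists (V X : finType) (vm : X -> V) :
  exists K : {ffun X -> 'I_d} -> R, tensor_span K /\
    forall P : edge_structure X, \sum_w K w * tensor R P w = f (mkgraph vm P).
Proof.
have [K sK KE] := @riesz_in_span R _ _ (fun P : edge_structure X => tensor R P)
  (fun P => f (mkgraph vm P)) (@f_tensor_relation V X vm).
by exists K.
Qed.

Definition kernel (V X : finType) (vm : X -> V) : {ffun X -> 'I_d} -> R :=
  sval (cid (kernel_exists vm)).

Lemma kernel_span (V X : finType) (vm : X -> V) : tensor_span (kernel vm).
Proof. by rewrite /kernel; case: cid => K []. Qed.

Lemma kernelE (V X : finType) (vm : X -> V) (P : edge_structure X) :
  \sum_w kernel vm w * tensor R P w = f (mkgraph vm P).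
Proof. by rewrite /kernel; case: cid => K []. Qed.

Lemma kernel_unique (V X : finType) (vm : X -> V) (K : {ffun X -> 'I_d} -> R) :
  tensor_span K ->
  (forall P : edge_structure X, \sum_w K w * tensor R P w = f (mkgraph vm P)) ->
  K =1 kernel vm.
Proof.
move=> sK KE; apply: (in_span_inj sK (kernel_span vm)) => P.
by rewrite KE kernelE.
Qed.

(** By uniqueness: the transported kernel lies in the span and has the same pairings with all
    tensors. *)
Lemma kernel_isomorphic (V V' X X' : finType) (vm : X -> V) (vm' : X' -> V')
    (fV : V -> V') (fH : X -> X') (w : {ffun X' -> 'I_d}) :
  bijective fV -> bijective fH -> (forall x, vm' (fH x) = fV (vm x)) ->
  kernel vm [ffun x => w (fH x)] = kernel vm' w.
Proof.
move=> bV bH HV.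
apply: (@kernel_unique _ _ vm' (fun w => kernel vm [ffun x => w (fH x)])).
  exact: tensor_span_reindex (kernel_span vm).
move=> P; transitivity (f (mkgraph vm (pullback bH P))).
  rewrite -kernelE; have [g fK gK] := bH.
  have br : bijective (fun w : {ffun X' -> 'I_d} => [ffun x => w (fH x)]).
    exists (fun w : {ffun X -> 'I_d} => [ffun x => w (g x)]) => v;
      by apply/ffunP => x; rewrite !ffunE ?fK ?gK.
  rewrite [RHS](reindex _ (onW_bij _ br)) /=.
  by apply: eq_bigr => v _; rewrite tensor_pullback.
apply: f_param; exists fV, id, fH; split=> //; first exact: inv_bij.
Qed.

(** Both sides, as functions of [w], lie in the tensor span, and multiplicativity of [f] gives them
    the same pairing with every tensor. *)
Lemma kernel_disjoint (V1 V2 X1 X2 : finType) (vm1 : X1 -> V1) (vm2 : X2 -> V2)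
    (P : edge_structure X1) (w : {ffun X2 -> 'I_d}) :
  \sum_u kernel (sum_map vm1 vm2) (fjoin u w) * tensor R P u
    = f (mkgraph vm1 P) * kernel vm2 w.
Proof.
apply: (in_span_inj (tensor_span_contract_left P (kernel_span (sum_map vm1 vm2)))
  (in_spanZ _ (kernel_span vm2))) => Q.
under [RHS]eq_bigr => v _ do rewrite -mulrA.
rewrite -big_distrr /= kernelE.
transitivity (f (mkgraph (sum_map vm1 vm2) (sum_structure P Q))).
  rewrite -kernelE sum_fjoin exchange_big /=; apply: eq_bigr => v _.
  by rewrite big_distrl /=; apply: eq_bigr => u _; rewrite tensor_sum mulrA.
have [fU _] := f_mult; rewrite -fU; apply: f_param.
exists id, id, id; split; try exact: inv_bij; rewrite //=.
Qed.

Lemma f_glue_kernel (V1 V2 X1 X2 Y : finType) (vm1 : X1 -> V1) (vm2 : X2 -> V2)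
    (P : edge_structure (X1 + Y)%type) (Q : edge_structure (X2 + Y)%type) :
  f (glue (mkfragment vm1 P) (mkfragment vm2 Q)) =
  \sum_(w1 : {ffun X1 -> 'I_d}) \sum_(w2 : {ffun X2 -> 'I_d})
    kernel (sum_map vm1 vm2) (fjoin w1 w2) *
    \sum_(u : {ffun Y -> 'I_d}) tensor R P (fjoin w1 u) * tensor R Q (fjoin w2 u).
Proof.
pose G := glue (mkfragment vm1 P) (mkfragment vm2 Q).
transitivity (f (mkgraph (sum_map vm1 vm2) (structure_of G))).
  by apply/esym/f_param; apply: (mkgraph_structure G).
rewrite -kernelE sum_fjoin; apply: eq_bigr => w1 _; apply: eq_bigr => w2 _.
by rewrite tensor_glue.
Qed.

Lemma kernel_sym (V1 V2 X1 X2 : finType) (vm1 : X1 -> V1) (vm2 : X2 -> V2)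
    (w1 : {ffun X1 -> 'I_d}) (w2 : {ffun X2 -> 'I_d}) :
  kernel (sum_map vm1 vm2) (fjoin w1 w2) = kernel (sum_map vm2 vm1) (fjoin w2 w1).
Proof.
pose sw (A B : Type) (z : A + B) : B + A :=
  match z with inl a => inr a | inr b => inl b end.
have swK A B : cancel (@sw A B) (@sw B A) by case.
rewrite -(@kernel_isomorphic _ _ _ _ (sum_map vm1 vm2) (sum_map vm2 vm1)
  (@sw V1 V2) (@sw X1 X2)); try by [exists (@sw _ _) | case].
by congr kernel; apply/ffunP => -[x|x]; rewrite !ffunE.
Qed.

(** * Positive semidefiniteness of the kernels *)

Section Positivity.
Variables (I : finType) (V X : I -> finType) (vm : forall i, X i -> V i).
Local Notation W := {i : I & {ffun X i -> 'I_d}}.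
Local Notation tag_word := (Tagged (fun i => {ffun X i -> 'I_d})).

(** The symmetric matrix [M] of the overview. Rows are pairs of an index [i] and a coloring of
    [X i], so that several vertex maps are treated at once. *)
Definition block (s t : W) : R :=
  kernel (sum_map (vm (i := tag s)) (vm (i := tag t))) (fjoin (tagged s) (tagged t)).

(** The matrix algebra containing [M]: each block, read as a tensor on [X i + X j], must be a
    combination of edge structures. *)
Definition block_span (B : W -> W -> R) := forall i j,
  tensor_span (fun w : {ffun X i + X j -> 'I_d} =>
    B (tag_word (fleft w))
      (tag_word (fright w))).

Lemma sum_block (F : W -> R) :
  \sum_s F s = \sum_i \sum_(u : {ffun X i -> 'I_d}) F (tag_word u).
Proof. by rewrite sig_big_dep /=; apply: eq_bigr => -[]. Qed.

Lemma block_span_swap (B : W -> W -> R) : block_span B ->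
  block_span (fun s t => B t s).
Proof.
move=> sB i j.
pose g (z : X j + X i) : X i + X j := match z with inl a => inr a | inr b => inl b end.
have bg : bijective g.
  by exists (fun z => match z with inl y => inr y | inr x => inl x end) => -[].
apply: in_span_ext (tensor_span_reindex bg (sB j i)) => w.
by congr (B _ _); congr (tag_word _); apply/ffunP => x; rewrite !ffunE.
Qed.

Lemma block_span_mul (A B : W -> W -> R) : block_span A -> block_span B ->
  block_span (fun s t => \sum_r A s r * B r t).
Proof.
move=> sA sB i j.
apply: in_span_ext (in_span_sum (index_enum I) (P := xpredT) (fun l _ =>
  tensor_span_contract (sA i l) (block_span_swap sB j l))) => w.
rewrite sum_block; apply: eq_bigr => l _; apply: eq_bigr => u _.
by rewrite !fleft_fjoin !fright_fjoin.
Qed.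

(** For a fixed column type [l], the blocks of [B] expand into edge structures on [X i + X l]. With
    the vertices of [vm i] attached they form one quantum graph with open ends [X l], and gluing it
    with itself gives the part of the sum over columns of type [l]. *)
Lemma block_trace_ge0 (B : W -> W -> R) : block_span B ->
  0 <= \sum_r \sum_s \sum_t block s t * (B s r * B t r).
Proof.
move=> sB; rewrite sum_block; apply: sumr_ge0 => l _.
pose S i := sval (cid (sB i l)); have SE i := svalP (cid (sB i l)).
pose frag i (p : R * edge_structure (X i + X l)%type) := (p.1, mkfragment (vm (i := i)) p.2).
pose Q := flatten [seq [seq frag i p | p <- S i] | i <- index_enum I].
have BE i (w : {ffun X i -> 'I_d}) (u : {ffun X l -> 'I_d}) :
    B (tag_word w) (tag_word u) = \sum_(p <- S i) p.1 * tensor R p.2 (fjoin w u).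
  by have := SE i (fjoin w u); rewrite fleft_fjoin fright_fjoin.
apply: (le_trans (f_rp Q)); rewrite quantum_eval_glue.
have QE (F : R * fragment #|X l| -> R) :
    \sum_(q <- Q) F q = \sum_i \sum_(p <- S i) F (frag i p).
  by rewrite big_flatten big_map /=; apply: eq_bigr => i _; rewrite big_map.
rewrite le_eqVlt; apply/orP; left; apply/eqP.
transitivity (\sum_i \sum_j \sum_(w : {ffun X i -> 'I_d}) \sum_(v : {ffun X j -> 'I_d})
  \sum_(u : {ffun X l -> 'I_d}) block (tag_word w) (tag_word v) *
   (B (tag_word w) (tag_word u) * B (tag_word v) (tag_word u))).
  rewrite QE; apply: eq_bigr => i _; under eq_bigr => p _ do rewrite QE.
  rewrite -exchange_sum_seq; apply: eq_bigr => j _ /=.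
  under [RHS]eq_bigr => w _ do (under eq_bigr => v _ do
   (under eq_bigr => u _ do (rewrite !BE big_distrlr big_distrr /=;
       under eq_bigr => p _ do rewrite big_distrr /=);
    rewrite exchange_sum_seq; under eq_bigr => p _ do rewrite exchange_sum_seq);
   rewrite exchange_sum_seq; under eq_bigr => p _ do rewrite exchange_sum_seq).
  rewrite exchange_sum_seq; apply: eq_bigr => p _.
  rewrite exchange_sum_seq; apply: eq_bigr => q _ /=.
  rewrite f_glue_kernel big_distrr /=; apply: eq_bigr => w _.
  rewrite big_distrr /=; apply: eq_bigr => v _.
  rewrite !big_distrr /=; apply: eq_bigr => u _.
  by rewrite /block /=; move: (kernel _ _) (tensor _ _ _) (tensor _ _ _) => x y z; ring.
under [RHS]eq_bigr => u _ do (rewrite sum_block;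
  under eq_bigr => i _ do under eq_bigr => w _ do rewrite sum_block).
rewrite [RHS]exchange_big /=; apply: eq_bigr => i _.
under [RHS]eq_bigr => u _ do rewrite exchange_big /=.
rewrite [RHS]exchange_big /=; apply: eq_bigr => j _.
rewrite [RHS]exchange_big /=; apply: eq_bigr => w _.
by rewrite [RHS]exchange_big.
Qed.

Lemma kernel_psd (c : I -> R) (w : forall i, {ffun X i -> 'I_d}) :
  0 <= \sum_i \sum_j c i * c j *
    kernel (sum_map (vm (i := i)) (vm (i := j))) (fjoin (w i) (w j)).
Proof.
pose K : 'M[R]_#|{: W}| := \matrix_(a, b) block (enum_val a) (enum_val b).
pose fn (B : 'M[R]_#|{: W}|) (s t : W) := B (enum_rank s) (enum_rank t).
have fnM (A B : 'M[R]_#|{: W}|) s t : fn (A *m B) s t = \sum_r fn A s r * fn B r t.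
  by rewrite /fn mxE (reindex_onto enum_rank enum_val) /=;
    [apply: eq_bigl => r; rewrite enum_rankK eqxx | move=> *; rewrite enum_valK].
have trE (A : 'M[R]_#|{: W}|) : \tr A = \sum_r fn A r r.
  by rewrite /fn /mxtrace (reindex_onto enum_rank enum_val) /=;
    [apply: eq_bigl => r; rewrite enum_rankK eqxx | move=> *; rewrite enum_valK].
have fnK s t : fn K s t = block s t by rewrite /fn mxE !enum_rankK.
(* The vector with entry [c i] at the pair of [i] and [w i], and zero elsewhere. *)
pose x : 'rV[R]_#|{: W}| := \row_a (c (tag (enum_val a)) *
  (w (tag (enum_val a)) == tagged (enum_val a))%:R).
have := @psd_of_trace R _ K (fun B => block_span (fn B)) _ _ _ _ _ _ x.
have xE s : x 0 (enum_rank s) = c (tag s) * (w (tag s) == tagged s)%:R.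
  by rewrite mxE !enum_rankK.
have sumx (F : W -> R) : \sum_s x 0 (enum_rank s) * F s
    = \sum_i c i * F (tag_word (w i)).
  rewrite sum_block; apply: eq_bigr => i _.
  rewrite (bigD1 (w i)) //= big1 => [|u ui]; rewrite xE /=.
    by rewrite eqxx mulr1 addr0.
  by rewrite eq_sym (negbTE ui) mulr0 mul0r.
have -> : (x *m K *m x^T) 0 0 = \sum_i \sum_j c i * c j *
    kernel (sum_map (vm (i := i)) (vm (i := j))) (fjoin (w i) (w j)).
  transitivity (\sum_s x 0 (enum_rank s) * \sum_t x 0 (enum_rank t) * block s t).
    rewrite mxE; under eq_bigr => a _ do rewrite mxE [x^T a 0]mxE big_distrl /=.
    rewrite exchange_big /= (reindex_onto enum_rank enum_val) /=; last by move=> *; rewrite enum_valK.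
    rewrite [LHS](eq_bigl predT); last by move=> r; rewrite enum_rankK eqxx.
    apply: eq_bigr => s _; rewrite big_distrr (reindex_onto enum_rank enum_val) /=; last by move=> *; rewrite enum_valK.
    rewrite [LHS](eq_bigl predT); last by move=> r; rewrite enum_rankK eqxx.
    by apply: eq_bigr => t _; rewrite -fnK /fn; ring.
  rewrite sumx; apply: eq_bigr => i _; rewrite sumx big_distrr /=.
  by apply: eq_bigr => j _; rewrite mulrA.
apply.
- by apply/matrixP => a b; rewrite !mxE /block kernel_sym.
- move=> i j; apply: in_span_ext (kernel_span (sum_map (vm (i := i)) (vm (i := j)))).
  by move=> u; rewrite fnK /block /= fjoin_fleft_fright.
- move=> A B sA sB i j; apply: in_span_ext (in_spanD (sA i j) (sB i j)) => u.
  by rewrite /fn [RHS]mxE.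
- move=> a A sA i j; apply: in_span_ext (in_spanZ a (sA i j)) => u.
  by rewrite /fn [RHS]mxE.
- move=> A B sA sB i j; apply: in_span_ext (block_span_mul sA sB i j) => u.
  by rewrite fnM.
- move=> B sB Bsym; apply: (le_trans (block_trace_ge0 sB)).
  rewrite le_eqVlt; apply/orP; left; apply/eqP.
  rewrite trE exchange_big; apply: eq_bigr => s _ /=.
  rewrite fnM exchange_big; apply: eq_bigr => t _ /=.
  rewrite fnK fnM big_distrr /=; apply: eq_bigr => r _.
  by rewrite /fn -[in X in _ * (X * _)]Bsym mxE [B _ _ * B _ _]mulrC.
Qed.

End Positivity.

End Kernel.

(** * Moments and the edge coloring model *)

Import finmap classical_sets monalg.

Lemma card_count_map (A : finType) (T : eqType) (g : A -> T) (t : T) :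
  #|[set x | g x == t]| = count_mem t [seq g x | x <- enum A].
Proof.
rewrite count_map cardE size_filter -enumT; apply: eq_count => x /=.
by rewrite !inE.
Qed.

Lemma perm_eq_map_card (A B : finType) (T : eqType) (g : A -> T) (h : B -> T) :
  (forall t, #|[set x | g x == t]| = #|[set y | h y == t]|) ->
  perm_eq [seq g x | x <- enum A] [seq h y | y <- enum B].
Proof.
by move=> gh; apply/allP => t _ /=; rewrite -!card_count_map gh.
Qed.

(** Corresponding fibres of [g] and [h] have equal size, so each point goes to the point of the same
    rank in the other fibre. *)
Lemma perm_eq_bijection (A B : finType) (T : eqType) (g : A -> T) (h : B -> T) :
  perm_eq [seq g x | x <- enum A] [seq h y | y <- enum B] ->
  exists2 phi : A -> B, bijective phi & forall x, h (phi x) = g x.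
Proof.
move=> gh.
have cardgh t : #|[set x | g x == t]| = #|[set y | h y == t]|.
  by rewrite !card_count_map (seq.permP gh).
pose fg x := enum [set z | g z == g x]; pose fh x := enum [set y | h y == g x].
(* No default element of [B] is at hand, so the image serves as its own default; the bound on the
   index makes the choice harmless. *)
have exphi x : exists y, (index x (fg x) < size (fh x))%N
    /\ nth y (fh x) (index x (fg x)) = y.
  have lt : (index x (fg x) < size (fh x))%N.
    by rewrite -cardE -cardgh cardE index_mem mem_enum inE.
  case E : (fh x) lt => [//|y s] lt.
  exists (nth y (y :: s) (index x (fg x))); split=> //.
  exact: set_nth_default.
have [phi phiP] := choice exphi.
have hphi x : h (phi x) = g x.
  have [lt e] := phiP x; have : phi x \in fh x by rewrite -e mem_nth.
  by rewrite mem_enum inE => /eqP.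
exists phi => //; apply: inj_card_bij => [x y xy|].
  have gxy : g x = g y by rewrite -!hphi xy.
  have [ltx ex] := phiP x; have [lty ey] := phiP y.
  have ffh : fh x = fh y by rewrite /fh gxy.
  have ffg : fg x = fg y by rewrite /fg gxy.
  have lty' : (index y (fg y) < size (fh x))%N by rewrite ffh.
  have ixy : index x (fg x) = index y (fg y).
    apply/eqP; rewrite -(nth_uniq (phi x) ltx lty' (enum_uniq _)) ex.
    by rewrite ffh (set_nth_default (phi y)) // ey xy.
  have xin : x \in fg x by rewrite mem_enum inE.
  have yin : y \in fg x by rewrite ffg mem_enum inE.
  by rewrite -(nth_index x xin) ixy -ffg nth_index.
by have := perm_size gh; rewrite !size_map -!enumT -!cardE => ->.
Qed.

Lemma sub_term (Z : zmodType) (J : finType) (c : Z) (j : J) (F : J -> Z) :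
  c - F j = (c - \sum_i F i) + \sum_(i | i != j) F i.
Proof. by rewrite [in RHS](bigD1 j) //= opprD addrA addrNK. Qed.

(** * Degree vectors of colored half-edges *)

Section DegreeVector.
Variable d : nat.

Definition degree_vector (V X : finType) (vm : X -> V) (w : {ffun X -> 'I_d})
    (v : V) : {ffun 'I_d -> nat} :=
  [ffun c => #|[set x | (vm x == v) && (w x == c)]|].

Definition degree_vectors (V X : finType) (vm : X -> V) (w : {ffun X -> 'I_d}) :=
  [seq degree_vector vm w v | v <- enum V].

Lemma degree_vectors_sum (V1 V2 X1 X2 : finType) (vm1 : X1 -> V1)
    (vm2 : X2 -> V2) (w1 : {ffun X1 -> 'I_d}) (w2 : {ffun X2 -> 'I_d}) :
  perm_eq (degree_vectors (sum_map vm1 vm2) (fjoin w1 w2))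
    (degree_vectors vm1 w1 ++ degree_vectors vm2 w2).
Proof.
have -> : degree_vectors vm1 w1 ++ degree_vectors vm2 w2 =
    [seq degree_vector (sum_map vm1 vm2) (fjoin w1 w2) v |
       v <- [seq inl v | v <- enum V1] ++ [seq inr v | v <- enum V2]].
  rewrite /degree_vectors map_cat -!map_comp; congr (_ ++ _); apply: eq_map => v;
    apply/ffunP => c; rewrite !ffunE card_sum_set.
    rewrite [X in (_ + X)%N]eq_card0 ?addn0 => [|x]; last by rewrite inE.
    by apply: eq_card => x; rewrite !inE ffunE.
  rewrite [X in (X + _)%N]eq_card0 => [|x]; last by rewrite inE.
  by apply: eq_card => x; rewrite !inE ffunE.
apply/perm_map/uniq_perm; first exact: enum_uniq.
  rewrite cat_uniq; apply/and3P; split.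
  - by rewrite map_inj_uniq ?enum_uniq // => ? ? [].
  - by apply/hasPn => _ /mapP[v _ ->]; apply/negP => /mapP[u _].
  - by rewrite map_inj_uniq ?enum_uniq // => ? ? [].
move=> v; rewrite mem_enum mem_cat inE; apply/esym.
by case: v => v; apply/orP; [left|right]; apply/mapP; exists v; rewrite ?mem_enum.
Qed.

(** Realizes a prescribed list of degree vectors: vertex [p.1] receives as many half-edges of color
    [p.2] as its vector demands. *)
Definition canonical_halfedge (m : seq {ffun 'I_d -> nat}) : finType :=
  {p : 'I_(size m) * 'I_d & 'I_(tnth (in_tuple m) p.1 p.2)}.

Definition canonical_vertex (m : seq {ffun 'I_d -> nat})
  (x : canonical_halfedge m) : 'I_(size m) := (tag x).1.

Definition canonical_coloring (m : seq {ffun 'I_d -> nat}) :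
  {ffun canonical_halfedge m -> 'I_d} := [ffun x => (tag x).2].

Lemma canonical_degree_vectors m :
  degree_vectors (@canonical_vertex m) (canonical_coloring m) = m.
Proof.
rewrite -[RHS](map_tnth_enum (in_tuple m)); apply: eq_map => v.
apply/ffunP => c; rewrite ffunE.
pose F i := @Tagged _ (v, c) (fun p => 'I_(tnth (in_tuple m) p.1 p.2)) i.
have F_inj : injective F by move=> i j /eqP; rewrite eq_Tagged => /eqP.
rewrite -[RHS]card_ord -(card_codom F_inj); apply: eq_card => x.
rewrite inE ffunE /canonical_vertex; apply/andP/codomP => [|[i ->]]; last by rewrite !eqxx.
case: x => -[v' c'] i /= [/eqP ev /eqP ec].
by move: i; rewrite ev ec => i; exists i.
Qed.

End DegreeVector.

Section ParallelEdges.
Variables (d : nat) (E : finType).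

Definition parallel_structure : edge_structure (E * bool)%type.
Proof.
apply: (@EdgeStructure _ E fst) => e.
rewrite (_ : [set x | x.1 == e] = [set (e, true); (e, false)]).
  by rewrite cards2 xpair_eqE andbF.
by apply/setP => -[x []]; rewrite !inE !xpair_eqE ?andbT ?andbF ?orbF.
Defined.

Definition parallel_graph : graph := mkgraph (@snd E bool) parallel_structure.

(** Both vertices see the same degree vector, so the polynomial of this graph is a sum of squares of
    variables. *)
Lemma parallel_graph_color_degrees (psi : {ffun E -> 'I_d}) (v : bool) :
  @color_degrees d parallel_graph psi v = [ffun c => #|[set e | psi e == c]|].
Proof.
apply/ffunP => c; rewrite !ffunE.
have inj : injective (fun e : E => (e, v)) by move=> x y [].
rewrite -[RHS](card_imset _ inj); apply: eq_card => -[e u].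
rewrite inE /=; apply/andP/imsetP => [[/eqP -> ec]|[e' ec [-> ->]]].
  by exists e; rewrite ?inE.
by rewrite inE in ec.
Qed.

End ParallelEdges.

Section Moments.
Variables (R : realType) (f : graph -> R).
Hypotheses (f_param : graph_parameter f) (f_mult : Defs.multiplicative f).
Variables (d : nat) (K : forall V X : finType, (X -> V) -> {ffun X -> 'I_d} -> R).
Hypotheses
  (K_iso : forall (V V' X X' : finType) (vm : X -> V) (vm' : X' -> V')
    (fV : V -> V') (fH : X -> X') (w : {ffun X' -> 'I_d}),
    bijective fV -> bijective fH -> (forall x, vm' (fH x) = fV (vm x)) ->
    K vm [ffun x => w (fH x)] = K vm' w)
  (K_tensor : forall (V X : finType) (vm : X -> V) (P : edge_structure X),
    \sum_w K vm w * tensor R P w = f (mkgraph vm P))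
  (K_disjoint : forall (V1 V2 X1 X2 : finType) (vm1 : X1 -> V1) (vm2 : X2 -> V2)
    (P : edge_structure X1) (w : {ffun X2 -> 'I_d}),
    \sum_u K (sum_map vm1 vm2) (fjoin u w) * tensor R P u
      = f (mkgraph vm1 P) * K vm2 w)
  (K_psd : forall (I : finType) (V X : I -> finType)
    (vm : forall i, X i -> V i) (c : I -> R) (w : forall i, {ffun X i -> 'I_d}),
    0 <= \sum_i \sum_j c i * c j *
      K (sum_map (vm i) (vm j)) (fjoin (w i) (w j))).

Local Notation degrees := {ffun 'I_d -> nat}.

(** Vertices are matched by degree vector, then half-edges by vertex and color. Thus [K] depends
    only on the multiset of degree vectors, that is, on a monomial. *)
Lemma K_degrees (V V' X X' : finType) (vm : X -> V) (vm' : X' -> V') w w' :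
  perm_eq (degree_vectors vm w) (degree_vectors vm' w') -> K vm w = K vm' w'.
Proof.
move=> /perm_eq_bijection[fV bV fVE]; have [gV fK gK] := bV.
have /perm_eq_bijection[fH bH fHE] :
    perm_eq [seq (fV (vm x), w x) | x <- enum X] [seq (vm' x, w' x) | x <- enum X'].
  apply: perm_eq_map_card => -[v c].
  have /ffunP/(_ c) := fVE (gV v); rewrite gK !ffunE => e.
  transitivity #|[set x | (vm x == gV v) && (w x == c)]|.
    apply: eq_card => x; rewrite !inE.
    apply/eqP/andP => [[<- ->]|[/eqP vx /eqP->]]; first by rewrite fK !eqxx.
    by rewrite vx gK.
  by rewrite -e; apply: eq_card => x; rewrite !inE.
rewrite -(K_iso (vm := vm) w' bV bH) => [|x]; last by case: (fHE x).
by congr K; apply/ffunP => x; rewrite ffunE; case: (fHE x).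
Qed.

Definition moment (m : seq degrees) : R :=
  K (@canonical_vertex d m) (canonical_coloring m).

Lemma momentE (V X : finType) (vm : X -> V) w m :
  perm_eq m (degree_vectors vm w) -> moment m = K vm w.
Proof. by move=> h; apply: K_degrees; rewrite canonical_degree_vectors. Qed.

Definition monomial_factors (k : {cmonom degrees}) : seq degrees :=
  flatten [seq nseq (k i) i | i <- finsupp k].

Lemma count_monomial_factors k i : count_mem i (monomial_factors k) = k i.
Proof.
rewrite count_flatten sumnE !big_map.
under eq_bigr => j _ do rewrite count_nseq /=.
have [ik|ik] := boolP (i \in finsupp k).
  rewrite (bigD1_seq i) ?fset_uniq //= eqxx mul1n big1 ?addn0 // => j.
  by move/negbTE => ->.
rewrite big1_seq => [|j /andP[_ jk]].
  by apply/esym/eqP; rewrite cmE_eq0.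
by case: (j =P i) => // ji; move: ik; rewrite -ji jk.
Qed.

Lemma perm_monomial_factors (k : {cmonom degrees}) (s : seq degrees) :
  (forall i, k i = count_mem i s) -> perm_eq (monomial_factors k) s.
Proof.
by move=> ks; apply/allP => i _ /=; rewrite count_monomial_factors ks.
Qed.

Local Notation polys := {malg R[{cmonom degrees}]}.

(** The functional [L] of the overview: a variable is a degree vector, and a monomial is evaluated
    by [K] on a canonical realization. *)
Definition moment_functional (a : polys) : R :=
  mmap idfun (fun k => moment (monomial_factors k)) a.
Local Notation L := moment_functional.

Lemma LD a b : L (a + b) = L a + L b.
Proof. by rewrite /L mmapD. Qed.

Lemma LB a b : L (a - b) = L a - L b.
Proof. by rewrite /L mmapB. Qed.

Lemma L_sum (J : Type) (r : seq J) (P : pred J) (F : J -> polys) :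
  L (\sum_(j <- r | P j) F j) = \sum_(j <- r | P j) L (F j).
Proof. exact: (raddf_sum (mmap idfun (fun k => moment (monomial_factors k)))). Qed.

Lemma LU c k : L << c *g k >> = c * moment (monomial_factors k).
Proof. by rewrite /L mmapU. Qed.

Lemma LZ c a : L (c *: a) = c * L a.
Proof.
rewrite /L (mmapEw (msuppZ_le c a)) mmapE big_distrr /=.
by apply: eq_bigr => k _; rewrite mcoeffZ mulrA.
Qed.

Lemma LM a b : L (a * b) = \sum_(k1 <- msupp a) \sum_(k2 <- msupp b)
  a@_k1 * b@_k2 * moment (monomial_factors (mmul k1 k2)).
Proof.
rewrite malgME L_sum; apply: eq_bigr => k1 _.
by rewrite L_sum; apply: eq_bigr => k2 _; rewrite LU.
Qed.

(** The coefficients of [b] are the vector tested against the kernels; a product of monomials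
    corresponds to a disjoint union of realizations. *)
Lemma L_sqr_ge0 b : 0 <= L (b ^+ 2).
Proof.
rewrite expr2 LM big_seq_fsetE /=; under eq_bigr => k1 _ do rewrite big_seq_fsetE /=.
pose F (k : msupp b) := monomial_factors (val k).
apply: (le_trans (K_psd (fun k : msupp b => @canonical_vertex d (F k))
  (fun k : msupp b => b@_(val k)) (fun k => canonical_coloring (F k)))).
rewrite le_eqVlt; apply/orP; left; apply/eqP.
apply: eq_bigr => k1 _; apply: eq_bigr => k2 _; congr (_ * _).
apply/esym/momentE; rewrite perm_sym.
apply: (perm_trans (degree_vectors_sum _ _ _ _)).
rewrite !canonical_degree_vectors perm_sym; apply: perm_monomial_factors => i.
by rewrite cmM count_cat !count_monomial_factors.
Qed.

Definition color_monomial (G : graph) (psi : {ffun edge G -> 'I_d}) : {cmonom degrees} :=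
  \big[mmul/mone]_(v : vertex G) ucm (color_degrees psi v).

(** The polynomial [q_G]: the partition function with a variable in place of each value of the
    model. *)
Definition graph_poly (G : graph) : polys :=
  \sum_(psi : {ffun edge G -> 'I_d}) << color_monomial psi >>.

Lemma color_monomialE (G : graph) (psi : {ffun edge G -> 'I_d}) i :
  color_monomial psi i = count_mem i (degree_vectors (@vertex_of 0 G)
    [ffun h => psi (edge_of h)]).
Proof.
rewrite /color_monomial (big_morph (fun m : {cmonom degrees} => m i)
  (fun m1 m2 => cmM i m1 m2) (cm1 i)).
rewrite count_map -sum1_count big_enum_cond /= [RHS]big_mkcond /=.
apply: eq_bigr => v _; rewrite cmU.
rewrite (_ : color_degrees psi v = degree_vector (@vertex_of 0 G) [ffun h => psi (edge_of h)] v).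
  by case: eqP.
by apply/ffunP => c; rewrite !ffunE; apply: eq_card => h; rewrite !inE ffunE.
Qed.

(** For each monomial of [b], summing over colorings of [G] contracts the kernel of a disjoint union
    with the tensor of [G], so [f G] factors out by [K_disjoint]. *)
Lemma L_graph_poly G b : L (graph_poly G * b) = f G * L b.
Proof.
transitivity (\sum_(psi : {ffun edge G -> 'I_d}) \sum_(k <- msupp b)
    b@_k * moment (monomial_factors (mmul (color_monomial psi) k))).
  rewrite big_distrl L_sum /=; apply: eq_bigr => psi _.
  by rewrite LM msuppU1 big_seq_fset1; apply: eq_bigr => k _; rewrite mcoeffUU mul1r.
rewrite exchange_big /= /L mmapE big_distrr /=; apply: eq_bigr => k _.
rewrite -big_distrr /= mulrCA; congr (_ * _).
have -> : f G = f (mkgraph (@vertex_of 0 G) (structure_of G)).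
  exact/esym/f_param/mkgraph_structure.
rewrite -K_disjoint sum_tensor; apply: eq_bigr => psi _; apply: momentE.
rewrite perm_sym; apply: (perm_trans (degree_vectors_sum _ _ _ _)).
rewrite canonical_degree_vectors perm_sym; apply: perm_monomial_factors => i.
by rewrite cmM count_cat color_monomialE count_monomial_factors.
Qed.

Lemma L1 : L 1 = 1.
Proof.
have -> : L 1 = moment [::].
  rewrite -mpolyC1E LU mul1r; congr moment; apply/nilP; rewrite /nilp size_eq0.
  apply/eqP/perm_nilP; apply: perm_monomial_factors => i; exact: cm1.
have [_ f0] := f_mult.
pose w0 : {ffun void -> 'I_d} := [ffun x : void => match x with end].
rewrite (@momentE _ _ (@id void) w0); last first.
  by rewrite /degree_vectors (_ : enum {: void} = [::]) //; apply/size0nil; rewrite -cardE card_void.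
rewrite -f0 -(f_param (G := mkgraph (@id void) (void_structure void))).
  rewrite -K_tensor (sum_ffun_void _ w0) tensor_nohalf; last by case.
  by rewrite card_void mulr1.
by apply: vertexless_isomorphic => //; try case; rewrite !card_void.
Qed.

Lemma LA c : L c%:A = c.
Proof. by rewrite LZ L1 mulr1. Qed.

Definition positive_module : set polys := fun a => forall b, 0 <= L (a * b ^+ 2).

Lemma positive_module_ge0 a : positive_module a -> 0 <= L a.
Proof. by move=> /(_ 1); rewrite expr1n mulr1. Qed.

Lemma positive_module_quadratic : quadratic_module positive_module.
Proof.
split.
- by move=> b; rewrite mul1r; apply: L_sqr_ge0.
- by move=> a b Sa Sb c; rewrite mulrDl LD addr_ge0.
- by move=> a b Sa c; rewrite -mulrA -exprMn; apply: Sa.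
Qed.

Lemma positive_module_proper : ~ positive_module (- 1).
Proof.
move=> /(_ 1); rewrite expr1n mulr1 -[X in L X]sub0r LB L1.
by rewrite -{1}(subrr (0 : polys)) LB subrr sub0r oppr_ge0 ler10.
Qed.

Lemma positive_module_graph G :
  positive_module (graph_poly G - (f G)%:A) /\
  positive_module ((f G)%:A - graph_poly G).
Proof.
have LG b : L ((f G)%:A * b) = L (graph_poly G * b).
  apply: (etrans (congr1 L (mulr_algl _ _))).
  exact: (etrans (LZ _ _) (esym (L_graph_poly _ _))).
split=> b; rewrite mulrBl LB subr_ge0 le_eqVlt; apply/orP; left; apply/eqP.
  exact: LG.
exact/esym/LG.
Qed.

Lemma malgUM (k1 k2 : {cmonom degrees}) :
  << mmul k1 k2 >> = << k1 >> * << k2 >> :> polys.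
Proof. by rewrite malgM_def fgmulUU mulr1. Qed.

Lemma color_monomial_prod (G : graph) (psi : {ffun edge G -> 'I_d}) :
  << color_monomial psi >> = \prod_v << ucm (color_degrees psi v) >> :> polys.
Proof.
exact: (big_morph (fun k : {cmonom degrees} => << k >> : polys) malgUM).
Qed.

Lemma generator_bounded (i : degrees) : qm_bounded positive_module << ucm i >>.
Proof.
(* One parallel edge per unit of [i], remembering a color: coloring each edge by its tag gives both
   vertices the degree vector [i], and the other colorings only add squares. *)
pose E : finType := {c : 'I_d & 'I_(i c)}.
have [_ SD _] := positive_module_quadratic.
pose y (psi : {ffun E -> 'I_d}) : polys := << ucm [ffun c => #|[set e | psi e == c]|] >>.
have gE : graph_poly (parallel_graph E) = \sum_(psi : {ffun E -> 'I_d}) y psi ^+ 2.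
  apply: eq_bigr => psi _; rewrite color_monomial_prod big_bool /=.
  by rewrite !parallel_graph_color_degrees expr2.
pose psi0 : {ffun E -> 'I_d} := [ffun e => tag e].
have y0 : y psi0 = << ucm i >>.
  congr (<< ucm _ >>); apply/ffunP => c; rewrite ffunE.
  pose F j := @Tagged _ c (fun c => 'I_(i c)) j.
  have F_inj : injective F by move=> j l /eqP; rewrite eq_Tagged => /eqP.
  rewrite -[RHS]card_ord -(card_codom F_inj); apply: eq_card => x.
  rewrite inE ffunE; apply/eqP/codomP => [|[j ->]] //.
  by case: x => c' j /= ec; move: j; rewrite ec => j; exists j.
set S := positive_module.
have Sb : S ((f (parallel_graph E))%:A - << ucm i >> ^+ 2).
  have -> : (f (parallel_graph E))%:A - << ucm i >> ^+ 2 =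
      ((f (parallel_graph E))%:A - graph_poly (parallel_graph E))
      + \sum_(psi | psi != psi0) y psi ^+ 2.
    rewrite gE -y0.
    exact: (sub_term _ _ (fun psi => y psi ^+ 2)).
  apply: SD; first by have [] := positive_module_graph (parallel_graph E).
  exact: (qm_sum_sqr _ _ _ positive_module_quadratic).
exists (f (parallel_graph E)); last exact: Sb.
apply: (le_trans (L_sqr_ge0 << ucm i >>)).
by have := positive_module_ge0 Sb; rewrite LB (LA (f _)) subr_ge0.
Qed.

Lemma monomial_factors_prod (k : {cmonom degrees}) :
  \big[mmul/mone]_(i <- monomial_factors k) ucm i = k.
Proof.
apply/eqP/cmP => i; rewrite (big_morph (fun m : {cmonom degrees} => m i)
  (fun m1 m2 => cmM i m1 m2) (cm1 i)).
rewrite -[RHS]count_monomial_factors -sum1_count [RHS]big_mkcond /=.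
by apply: eq_bigr => j _; rewrite cmU; case: eqP.
Qed.

Lemma monomial_prod c (k : {cmonom degrees}) :
  << c *g k >> = c%:A * \prod_(i <- monomial_factors k) << ucm i >> :> polys.
Proof.
have <- : << \big[mmul/mone]_(i <- monomial_factors k) ucm i >>
    = \prod_(i <- monomial_factors k) << ucm i >> :> polys.
  exact: (big_morph (fun k : {cmonom degrees} => << k >> : polys) malgUM).
rewrite monomial_factors_prod mulr_algl; apply/malgP => l.
by rewrite [LHS]mcoeffU [RHS]mcoeffZ mcoeffU mulrnAr mulr1.
Qed.

Lemma positive_module_archimedean (a : polys) : exists c, positive_module (c%:A - a).
Proof.
have qS := positive_module_quadratic.
apply: qm_bounded_le => //.
have b0 : qm_bounded positive_module 0 by rewrite -(scale0r (1 : polys)); apply: qm_bounded_const.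
rewrite [a]monalgE; apply: (big_ind (qm_bounded positive_module) b0) => [x y|k _].
  exact: (qm_boundedD qS).
rewrite monomial_prod.
apply: (qm_boundedM qS); first exact: (qm_bounded_const _ qS).
apply: (big_ind (qm_bounded positive_module)) => [|x y|i _].
- by rewrite -(scale1r (1 : polys)); apply: qm_bounded_const.
- exact: (qm_boundedM qS).
- exact: generator_bounded.
Qed.

(** Modulo the support of the maximal module [q_G] is the constant [f G], while [chi] turns [q_G]
    into the partition function of the values of [chi] at the variables. *)
Lemma edge_coloring_model_of_moments :
  exists t : edge_coloring_model R d, forall G, partition_function t G = f G.
Proof.
have [chi chiP] := archimedean_character positive_module_quadratic
  positive_module_proper positive_module_archimedean.
exists (fun i => chi << ucm i >>) => G.
have [S1 S2] := positive_module_graph G.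
rewrite -(chiP _ _ S1 S2) /graph_poly rmorph_sum; apply: eq_bigr => psi _.
by rewrite color_monomial_prod rmorph_prod.
Qed.

End Moments.

Unset Implicit Arguments.
(* [multiplicative] also names a notion of the algebra library. *)
Import Pilot.Defs.

Theorem theorem1 (R : realType) (f : graph -> R)
  (f_param : graph_parameter f)
  (f_rp : edge_reflection_positive f)
  (f_mult : multiplicative f) :
  exists (d : nat) (t : edge_coloring_model R d),
    forall G : graph, partition_function t G = f G.
Proof.
have [d f_circle] := circle_nat f_param f_rp f_mult; exists d.
apply: (@edge_coloring_model_of_moments R f f_param f_mult d
  (@kernel R f f_param f_rp f_mult d f_circle)).
- exact: kernel_isomorphic.
- exact: kernelE.
- exact: kernel_disjoint.
- exact: kernel_psd.
Qed.
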